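(* Let $\Upsilon$ and $\widehat\Upsilon$ be $\mathbf t$-modules over $K$ with $\tau$-composition series $$0=\Upsilon_0\subset\Upsilon_1\subset\cdots\subset\Upsilon_{n-1}\subset\Upsilon_n=\Upsilon,\qquad 0=\widehat\Upsilon_0\subset\widehat\Upsilon_1\subset\cdots\subset\widehat\Upsilon_{m-1}\subset\widehat\Upsilon_m=\widehat\Upsilon,$$ where the quotients $\sigma_i=\Upsilon_i/\Upsilon_{i-1}$ and $\widehat\sigma_j=\widehat\Upsilon_j/\widehat\Upsilon_{j-1}$ are Drinfeld modules such that $\deg_\tau\sigma_i>\deg_\tau\widehat\sigma_j$ for every pair $(i,j)$, $i\in\{1,\dots,n\}$, $j\in\{1,\dots,m\}$. Then the space $\mathrm{Ext}^1_\tau(\Upsilon,\widehat\Upsilon)$ has a structure of a $\mathbf t$-module coming from $\mathbf t$-reduction.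
   Context: Basic notation. Let $q$ be a power of a prime, $K$ a field with an $\mathbb F_q$-algebra homomorphism $\iota:\mathbb F_q[t]\to K$, and $\theta:=\iota(t)$. $K\{\tau\}$ is the twisted polynomial ring with $\tau u=u^q\tau$ for $u\in K$. A $\mathbf t$-module over $K$ of dimension $d$ is an $\mathbb F_q$-algebra homomorphism $\Phi:\mathbb F_q[t]\to \mathrm{Mat}_d(K\{\tau\})$ such that $\Phi_t:=\Phi(t)=(\theta I+N_\Phi)\tau^0+\sum_{i=1}^nA_i\tau^i$ with $N_\Phi,A_i\in\mathrm{Mat}_d(K)$ and $N_\Phi$ nilpotent; there is also the zero $\mathbf t$-module. $\deg_\tau\Phi:=\deg_\tau\Phi_t$. A Drinfeld module is a one-dimensional $\mathbf t$-module $\phi$ with $\phi_t\neq\theta\tau^0$, i.e. $\deg_\tau\phi\ge1$. For $\mathbf t$-modules $\Phi,\Psi$ of dimensions $d,e$, a morphism $\Psi\to\Phi$ is $f\in\mathrm{Mat}_{d\times e}(K\{\tau\})$ with $f\Psi_t=\Phi_tf$. $E_{i\times j}$ is the $e\times d$ matrix with $1$ in position $(i,j)$ and $0$ elsewhere. Extensions. $\mathrm{Ext}^1_\tau(\Phi,\Psi)$ is the Baer group of extensions $0\to\Psi\to\Gamma\to\Phi\to0$ of $\mathbf t$-modules. A biderivation is an $\mathbb F_q$-linear map $\delta:\mathbb F_q[t]\to\mathrm{Mat}_{e\times d}(K\{\tau\})$ with $\delta(ab)=\Psi(a)\delta(b)+\delta(a)\Phi(b)$; it is determined by $\delta_t:=\delta(t)$,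 which may be arbitrary, so $\mathrm{Der}(\Phi,\Psi)\cong\mathrm{Mat}_{e\times d}(K\{\tau\})$. Every short exact sequence $0\to\Psi\to\Gamma\to\Phi\to0$ is, up to isomorphism, given by a biderivation: $\Gamma_t=\begin{bmatrix}\Phi_t&0\\ \delta_t&\Psi_t\end{bmatrix}$, with $\Psi\to\Gamma$ the inclusion on the second block of coordinates and $\Gamma\to\Phi$ the projection on the first. For $U\in\mathrm{Mat}_{e\times d}(K\{\tau\})$ the inner biderivation $\delta^{(U)}$ is given by $\delta^{(U)}_t=U\Phi_t-\Psi_tU$, and $\mathrm{Der}_{in}(\Phi,\Psi)$ is the set of these. One has $\mathrm{Ext}^1_\tau(\Phi,\Psi)\cong\mathrm{Der}(\Phi,\Psi)/\mathrm{Der}_{in}(\Phi,\Psi)$ as $\mathbb F_q[t]$-modules, with $t*\delta=\Psi_t\cdot\delta_t$. Composition series. A $\mathbf t$-module $\Psi$ is a $\tau$-submodule of $\Upsilon$ if there is a short exact sequence of $\mathbf t$-modules $0\to\Psi\to\Upsilon\to\Upsilon/\Psi\to0$. A $\mathbf t$-module is $\tau$-simple if it is not the middle term of a short exact sequence of $\mathbf t$-modules with nonzero terms (Drinfeld modules are $\tau$-simple). A $\tau$-composition series of $\Upsilon$ is a sequence $0=\Upsilon_0\subset\cdots\subset\Upsilon_n=\Upsilon$ in which each inclusion is that of a $\tau$-submodule and each quotient $\mathbf t$-module $\Upsilon_{i}/\Upsilon_{i-1}$ is $\tau$-simple. $\mathbf t$-reduction. For a matrix $N=[n_{i,j}]$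 of non-negative integers let $\mathrm{Mat}_{e\times d}(K\{\tau\})_{<N}$ be the set of $[w_{i,j}]\in \mathrm{Mat}_{e\times d}(K\{\tau\})$ with $\deg_\tau w_{i,j}<n_{i,j}$ for all $i,j$. A basis $(U_{i\times j})$ of $\mathrm{Mat}_{e\times d}(K)$ is said to satisfy conditions A–D (for $\Phi,\Psi$) if: (A) the inner biderivations $\delta^{(c\tau^kU_{i\times j})}$ ($c\in K$, $k\ge0$) form a basis of $\mathrm{Der}_{in}(\Phi,\Psi)$, in the sense that every inner biderivation is uniquely a finite sum of $\delta^{(c_{i,j,k}\tau^kU_{i\times j})}$, one for each triple $(i,j,k)$, with $c_{i,j,k}\in K$; (B) for $c\neq0$ the $(i,j)$ entry of $\delta_t^{(c\tau^kU_{i\times j})}$ is a twisted polynomial whose coefficient at the biggest power of $\tau$ is $c$; (C) with $N=[n_{i,j}]$, $n_{i,j}$ the $\tau$-degree of the $(i,j)$ entry of $\delta_t^{(c\tau^0U_{i\times j})}$ ($c\ne0$), every biderivation $\delta$ can be reduced, by subtracting finitely many $\delta^{(c_l\tau^{k_l}U_{i_l\times j_l})}$, to an element of $\mathrm{Mat}_{e\times d}(K\{\tau\})_{<N}$; (D) different elements of $\mathrm{Mat}_{e\times d}(K\{\tau\})_{<N}$ represent different elements of $\mathrm{Ext}^1_\tau(\Phi,\Psi)$. Then $\mathrm{Ext}^1_\tau(\Phi,\Psi)\cong\mathrm{Mat}_{e\times d}(K\{\tau\})_{<N}$ as $\mathbb F_q$-spaces. Transfer multiplication by $t$: for each generator $E_{i\times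 j}c\tau^k$ ($0\le k<n_{i,j}$, $c\in K$) reduce $\Psi_t E_{i\times j}c\tau^k$ to an element of $\mathrm{Mat}_{e\times d}(K\{\tau\})_{<N}$ and write the coordinates in the system $E_{a\times b}\tau^l$ as values at $c$ of twisted polynomials in $K\{\tau\}$ (with $\tau^m$ evaluated at $c$ being $c^{q^m}$). The resulting vectors of twisted polynomials are the columns of a square matrix $\Pi_t$ of size $\sum n_{i,j}$. One says that $\mathrm{Ext}^1_\tau(\Phi,\Psi)$ has a $\mathbf t$-module structure coming from $\mathbf t$-reduction if such a basis $(U_{i\times j})$ exists and the procedure yields a $\mathbf t$-module $t\mapsto\Pi_t$.
   Formalization: As t-reduction depends on coordinates and the claim fails in arbitrary ones, it is proved for all t-modules isomorphic to Υ, Υ̂ (compatibly with the series) in which each step of the series is in block form given by a biderivation; such forms are shown to exist. *)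

(* Defs.v *)
From HB Require Import structures.
From mathcomp Require Import all_boot all_order all_algebra all_fingroup all_field.

Set Implicit Arguments.
Unset Strict Implicit.
Unset Printing Implicit Defensive.

Import GRing.Theory.
Local Open Scope ring_scope.

(* Skew polynomial ring R{tau; sigma}, with tau * u = sigma u * tau.  The      *)
(* carrier is {poly R}: p`_i is the coefficient standing on the left of tau^i. *)
Definition skew (R : nzRingType) (sigma : {rmorphism R -> R}) := {poly R}.

HB.instance Definition _ (R : nzRingType) (sigma : {rmorphism R -> R}) :=
  GRing.Zmodule.on (skew sigma).

Section SkewRing.
Variables (R : nzRingType) (sigma : {rmorphism R -> R}).
Implicit Types p q r : skew sigma.

Definition skew_mul p q : skew sigma :=
  \poly_(i < (size p + size q).-1)
    (\sum_(j < i.+1) p`_j * iter j sigma q`_(i - j)).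

Lemma iter_sigma0 k : iter k sigma 0 = 0.
Proof. by elim: k => //= k ->; rewrite rmorph0. Qed.

Lemma iter_sigma1 k : iter k sigma 1 = 1.
Proof. by elim: k => //= k ->; rewrite rmorph1. Qed.

Lemma iter_sigmaD k x y : iter k sigma (x + y) = iter k sigma x + iter k sigma y.
Proof. by elim: k => //= k ->; rewrite rmorphD. Qed.

Lemma iter_sigmaM k x y : iter k sigma (x * y) = iter k sigma x * iter k sigma y.
Proof. by elim: k => //= k ->; rewrite rmorphM. Qed.

Lemma iter_sigma_sum k (I : Type) (s : seq I) (P : pred I) (f : I -> R) :
  iter k sigma (\sum_(i <- s | P i) f i) = \sum_(i <- s | P i) iter k sigma (f i).
Proof.
exact: (big_morph (iter k sigma) (iter_sigmaD k) (iter_sigma0 k)).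
Qed.

Lemma coef_skew_mul p q i :
  (skew_mul p q)`_i = \sum_(j < i.+1) p`_j * iter j sigma q`_(i - j).
Proof.
rewrite coef_poly ltn_predRL; case: leqP => // le_pq_i1.
rewrite big1 // => j _; have [lq_p_j|lt_j_p] := leqP (size p) j.
  by rewrite nth_default ?mul0r.
rewrite [q`__]nth_default ?iter_sigma0 ?mulr0 // leq_subRL -ltnS //.
by rewrite (leq_trans _ le_pq_i1) // ltn_add2r.
Qed.

Lemma coef_skew_mul_rev p q i :
  (skew_mul p q)`_i = \sum_(j < i.+1) p`_(i - j) * iter (i - j) sigma q`_j.
Proof.
rewrite coef_skew_mul (reindex_inj rev_ord_inj) /=.
by apply: eq_bigr => j _; rewrite (sub_ordK j).
Qed.

Lemma skew_mulA : associative skew_mul.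
Proof.
move=> p q r; apply/polyP=> i; rewrite coef_skew_mul coef_skew_mul_rev.
pose coef3 j k :=
  p`_j * (iter j sigma q`_(i - j - k) * iter (i - k) sigma r`_k).
transitivity (\sum_(j < i.+1) \sum_(k < i.+1 | (k <= i - j)%N) coef3 j k).
  apply: eq_bigr => /= j _.
  rewrite coef_skew_mul_rev iter_sigma_sum big_distrr /=.
  rewrite (big_ord_narrow_leq (leq_subr _ _)); apply: eq_bigr => k _ /=.
  rewrite iter_sigmaM -iterD /coef3; congr (_ * (_ * iter _ _ _)).
  have le_k : (k <= i - j)%N by rewrite -ltnS.
  by rewrite addnBA // subnKC // -ltnS.
rewrite (exchange_big_dep predT) //=; apply: eq_bigr => k _.
transitivity (\sum_(j < i.+1 | (j <= i - k)%N) coef3 j k).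
  apply: eq_bigl => j; rewrite -ltnS -(ltnS j) -!subSn ?leq_ord //.
  by rewrite -subn_gt0 -(subn_gt0 j) -!subnDA addnC.
rewrite (big_ord_narrow_leq (leq_subr _ _)) coef_skew_mul big_distrl /=.
by apply: eq_bigr => j _; rewrite /coef3 -!subnDA addnC mulrA.
Qed.

Lemma skew_mul1l : left_id (1%:P : skew sigma) skew_mul.
Proof.
move=> p; apply/polyP => i; rewrite coef_skew_mul big_ord_recl subn0.
by rewrite big1 => [|j _]; rewrite coefC /= ?mul0r // mul1r addr0.
Qed.

Lemma skew_mul1r : right_id (1%:P : skew sigma) skew_mul.
Proof.
move=> p; apply/polyP => i; rewrite coef_skew_mul_rev big_ord_recl subn0.
rewrite big1 => [|j _]; rewrite coefC /= ?iter_sigma0 ?mulr0 //.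
by rewrite iter_sigma1 mulr1 addr0.
Qed.

Lemma skew_mulDl : left_distributive skew_mul +%R.
Proof.
move=> p q r; apply/polyP=> i; rewrite coefD !coef_skew_mul -big_split.
by apply: eq_bigr => j _; rewrite coefD mulrDl.
Qed.

Lemma skew_mulDr : right_distributive skew_mul +%R.
Proof.
move=> p q r; apply/polyP=> i; rewrite coefD !coef_skew_mul -big_split.
by apply: eq_bigr => j _; rewrite coefD iter_sigmaD mulrDr.
Qed.

Lemma skew1_neq0 : (1%:P : skew sigma) != 0.
Proof. by rewrite polyC_eq0 oner_neq0. Qed.

HB.instance Definition _ := GRing.Zmodule_isNzRing.Build (skew sigma)
  skew_mulA skew_mul1l skew_mul1r skew_mulDl skew_mulDr skew1_neq0.

Definition skewC (c : R) : skew sigma := c%:P.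
Definition tau : skew sigma := 'X.

Lemma coef_skewM p q i :
  (p * q)`_i = \sum_(j < i.+1) p`_j * iter j sigma q`_(i - j).
Proof. exact: coef_skew_mul. Qed.

Lemma tau_skewC c : tau * skewC c = skewC (sigma c) * tau.
Proof.
apply/polyP=> i; rewrite !coef_skewM /tau /skewC.
case: i => [|i].
  by rewrite !big_ord1 !coefX /= mul0r mulr0.
rewrite !big_ord_recl big1 => [|j _]; last by rewrite coefX /= mul0r.
rewrite big1 => [|j _]; last by rewrite coefC /= mul0r.
rewrite !coefX !coefC /= mul0r mul1r addr0 add0r !subSS !subn0.
by case: i => [|i] /=; rewrite ?mulr1 ?mulr0 ?mul0r ?rmorph0 ?addr0.
Qed.

End SkewRing.

(* u |-> u^q on K, with iota as a parameter so that its being a ring morphism  *)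
(* (K has the characteristic of F) is found by inference.                      *)
Definition frobq (F : finFieldType) (K : fieldType)
  (iota : {rmorphism {poly F} -> K}) (x : K) : K := x ^+ #|F|.

Section Frobenius.
Variables (F : finFieldType) (K : fieldType) (iota : {rmorphism {poly F} -> K}).

Lemma frobq_is_zmod_morphism : zmod_morphism (frobq iota).
Proof.
have [p p_pr pF] := finPcharP F.
have pK : p \in [pchar K] by apply: (rmorph_pchar (iota \o polyC)).
have qK : [pchar K].-nat #|F|.
  by rewrite (card_pprimeChar pF) pnatX (eq_pnat _ (pcharf_eq pK)) pnat_id.
by move=> x y; rewrite /frobq exprDn_pchar // exprNn_pchar.
Qed.

Lemma frobq_is_monoid_morphism : monoid_morphism (frobq iota).
Proof. by split=> [|x y]; rewrite /frobq ?expr1n ?exprMn. Qed.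

HB.instance Definition _ :=
  GRing.isZmodMorphism.Build K K (frobq iota) frobq_is_zmod_morphism.
HB.instance Definition _ :=
  GRing.isMonoidMorphism.Build K K (frobq iota) frobq_is_monoid_morphism.

End Frobenius.

(* K{tau}; the F_q-algebra structure of K is c |-> iota c%:P. *)
Notation twpoly iota := (skew (frobq iota)).

Section TModules.
Variables (F : finFieldType) (K : fieldType) (iota : {rmorphism {poly F} -> K}).
Local Notation T := (twpoly iota).
Local Notation theta := (iota 'X).

Definition skewCmx m n (M : 'M[K]_(m, n)) : 'M[T]_(m, n) :=
  map_mx (@skewC K (frobq iota)) M.

Definition tmonom (c : K) (k : nat) : T := skewC (frobq iota) c * tau _ ^+ k.

Definition nilpotent_mx d (N : 'M[K]_d) : Prop := exists k : nat, N ^+ k = 0.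

Definition tmodule_shape d (M : 'M[T]_d) : Prop :=
  exists (N : 'M[K]_d) (n : nat) (A : nat -> 'M[K]_d),
    nilpotent_mx N /\
    M = skewCmx (theta%:M + N)
        + \sum_(1 <= i < n.+1) skewCmx (A i) *m (tau _ ^+ i)%:M.

(* Dimension 0 gives the zero t-module. *)
Record tmodule : Type := TModule {
  tdim : nat;
  tact :> {rmorphism {poly F} -> 'M[T]_tdim};
  tactC : forall c : F, tact c%:P = (skewC (frobq iota) (iota c%:P))%:M;
  tactX : tmodule_shape (tact 'X)
}.

(* The zero matrix gets degree 0; Mat_{<N} below uses size instead. *)
Definition deg_tau (Phi : tmodule) : nat :=
  \max_(i < tdim Phi) \max_(j < tdim Phi) (size (Phi 'X i j : T)).-1.

Definition drinfeld (phi : tmodule) : Prop :=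
  tdim phi = 1%N /\ phi 'X <> (skewC (frobq iota) theta)%:M.

Definition tmorphism (Psi Phi : tmodule) (f : 'M[T]_(tdim Phi, tdim Psi)) : Prop :=
  f *m Psi 'X = Phi 'X *m f.

Definition tisomorphism (Psi Phi : tmodule)
    (f : 'M[T]_(tdim Phi, tdim Psi)) : Prop :=
  tmorphism f /\
  exists g : 'M[T]_(tdim Psi, tdim Phi), g *m f = 1%:M /\ f *m g = 1%:M.

(* 0 -> Psi -f-> Gamma -g-> Phi -> 0.  Exactness of the underlying sequence of *)
(* group schemes G_a^e -> G_a^n -> G_a^d is exactness of the sequence of left  *)
(* K{tau}-modules of F_q-linear maps to G_a, i.e. of                           *)
(* 0 -> K{tau}^d -(.g)-> K{tau}^n -(.f)-> K{tau}^e -> 0 on row vectors.        *)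
Definition short_exact (Psi Gamma Phi : tmodule)
    (f : 'M[T]_(tdim Gamma, tdim Psi)) (g : 'M[T]_(tdim Phi, tdim Gamma)) : Prop :=
  [/\ tmorphism f, tmorphism g,
      forall v : 'rV[T]_(tdim Phi), v *m g = 0 -> v = 0,
      forall v : 'rV[T]_(tdim Gamma),
        v *m f = 0 <-> exists w : 'rV[T]_(tdim Phi), v = w *m g
    & forall w : 'rV[T]_(tdim Psi), exists v : 'rV[T]_(tdim Gamma), w = v *m f].

Definition tau_simple (Gamma : tmodule) : Prop :=
  ~ exists (Psi Phi : tmodule)
      (f : 'M[T]_(tdim Gamma, tdim Psi)) (g : 'M[T]_(tdim Phi, tdim Gamma)),
      [/\ (0 < tdim Psi)%N, (0 < tdim Gamma)%N, (0 < tdim Phi)%N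
        & short_exact f g].

(* ts_mod i is Upsilon_i (i <= n) and ts_quo i is the quotient                 *)
(* Upsilon_(i+1) / Upsilon_i (i < n); values at larger indices are junk.       *)
Record tau_series (n : nat) (Upsilon : tmodule) : Type := TauSeries {
  ts_mod : nat -> tmodule;
  ts_quo : nat -> tmodule;
  ts_inc : forall i, 'M[T]_(tdim (ts_mod i.+1), tdim (ts_mod i));
  ts_proj : forall i, 'M[T]_(tdim (ts_quo i), tdim (ts_mod i.+1));
  ts_first : tdim (ts_mod 0) = 0%N;
  ts_last : ts_mod n = Upsilon;
  ts_exact : forall i, (i < n)%N -> short_exact (ts_inc i) (ts_proj i);
  ts_simple : forall i, (i < n)%N -> tau_simple (ts_quo i)
}.

(* Every step of the series is given by a biderivation:                        *)
(*   (Upsilon_(i+1))_t = [sigma_t, 0; delta_t, (Upsilon_i)_t],                 *)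
(* Upsilon_i being included as the second block of coordinates and the         *)
(* projection onto sigma being that on the first block.                        *)
Definition block_series n Upsilon (S : tau_series n Upsilon) : Prop :=
  forall i, (i < n)%N ->
  [/\ tdim (ts_mod S i.+1) = (tdim (ts_quo S i) + tdim (ts_mod S i))%N,
      ts_inc S i = \matrix_(a, b) ((a == tdim (ts_quo S i) + b :> nat)%N)%:R
    & ts_proj S i = \matrix_(a, b) ((a == b :> nat)%N)%:R].

Definition series_iso n Upsilon Upsilon' (S : tau_series n Upsilon)
    (S' : tau_series n Upsilon') : Prop :=
  exists (h : forall i, 'M[T]_(tdim (ts_mod S' i), tdim (ts_mod S i)))
         (k : forall i, 'M[T]_(tdim (ts_quo S' i), tdim (ts_quo S i))),
    (forall i, (i <= n)%N -> tisomorphism (h i)) /\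
    (forall i, (i < n)%N ->
      [/\ tisomorphism (k i),
          h i.+1 *m ts_inc S i = ts_inc S' i *m h i
        & k i *m ts_proj S i = ts_proj S' i *m h i.+1]).

(* Upsilon' is Upsilon written in coordinates in which all the short exact     *)
(* sequences of the series S are given by biderivations.  Conditions A-D refer *)
(* to matrix entries and bases of Mat(K), so they are sensitive to changes of  *)
(* coordinates in GL(K{tau}) and are to be tested in such coordinates.         *)
Definition presentation n Upsilon (S : tau_series n Upsilon)
    (Upsilon' : tmodule) : Prop :=
  exists S' : tau_series n Upsilon', block_series S' /\ series_iso S S'.

Definition biderivation (Phi Psi : tmodule)
    (delta : {poly F} -> 'M[T]_(tdim Psi, tdim Phi)) : Prop :=
  (forall (c : F) (a b : {poly F}),
     delta (c *: a + b) = skewC _ (iota c%:P) *: delta a + delta b) /\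
  (forall a b : {poly F}, delta (a * b) = Psi a *m delta b + delta a *m Phi b).

Definition inner (Phi Psi : tmodule) (U : 'M[T]_(tdim Psi, tdim Phi))
    (a : {poly F}) : 'M[T]_(tdim Psi, tdim Phi) :=
  U *m Phi a - Psi a *m U.

(* delta and delta' define the same class in                                   *)
(* Ext^1_tau(Phi, Psi) = Der(Phi, Psi) / Der_in(Phi, Psi).                      *)
Definition ext_eq (Phi Psi : tmodule)
    (delta delta' : {poly F} -> 'M[T]_(tdim Psi, tdim Phi)) : Prop :=
  exists U : 'M[T]_(tdim Psi, tdim Phi),
    forall a, delta a - delta' a = inner U a.

(* Mat_{<N}: deg_tau (w i j) < N i j for all i, j, with deg_tau 0 = -oo. *)
Definition mat_lt e d (N : 'M[nat]_(e, d)) (w : 'M[T]_(e, d)) : Prop :=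
  forall i j, (size (w i j : T) <= N i j)%N.

End TModules.

Section TReduction.
Variables (F : finFieldType) (K : fieldType) (iota : {rmorphism {poly F} -> K}).
Variables (Phi Psi : tmodule iota).
Local Notation T := (twpoly iota).
Local Notation d := (tdim Phi).
Local Notation e := (tdim Psi).
Variable U : 'I_e -> 'I_d -> 'M[K]_(e, d).

(* delta^(c tau^k U_(i x j)) *)
Definition inner_gen (c : K) (k : nat) (i : 'I_e) (j : 'I_d) (a : {poly F}) :
    'M[T]_(e, d) :=
  inner (tmonom iota c k *: skewCmx iota (U i j)) a.

(* A finitely supported family (c_(i,j,k)) is encoded as a matrix of           *)
(* polynomials C, with c_(i,j,k) = (C i j)`_k.                                 *)
Definition cond_A : Prop :=
  forall V : 'M[T]_(e, d), exists! C : 'M[{poly K}]_(e, d),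
    forall a, inner V a =
      \sum_i \sum_j \sum_(k < size (C i j)) inner_gen (C i j)`_k k i j a.

Definition cond_B : Prop :=
  forall i j k c, c != 0 -> lead_coef (inner_gen c k i j 'X i j : T) = c.

Definition cond_N (N : 'M[nat]_(e, d)) : Prop :=
  forall i j c, c != 0 -> size (inner_gen c 0 i j 'X i j : T) = (N i j).+1.

Definition cond_C (N : 'M[nat]_(e, d)) : Prop :=
  forall delta : {poly F} -> 'M[T]_(e, d), biderivation delta ->
  exists s : seq (K * nat * ('I_e * 'I_d)),
    mat_lt N (delta 'X - \sum_(x <- s) inner_gen x.1.1 x.1.2 x.2.1 x.2.2 'X).

Definition cond_D (N : 'M[nat]_(e, d)) : Prop :=
  forall delta delta' : {poly F} -> 'M[T]_(e, d),
    biderivation delta -> biderivation delta' ->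
    mat_lt N (delta 'X) -> mat_lt N (delta' 'X) ->
    ext_eq delta delta' -> delta 'X = delta' 'X.

End TReduction.

(* p(c), tau^m being evaluated at c as c^(q^m). *)
Definition tw_eval (F : finFieldType) (K : fieldType)
    (iota : {rmorphism {poly F} -> K}) (p : twpoly iota) (c : K) : K :=
  \sum_(m < size p) p`_m * c ^+ (#|F| ^ m).

Section Extension.
Variables (F : finFieldType) (K : fieldType) (iota : {rmorphism {poly F} -> K}).
Variables (L : fieldType) (eps : {rmorphism K -> L}).

Definition ext_tw (p : twpoly iota) : twpoly (eps \o iota) := map_poly eps p.

Definition ext_mx m n (M : 'M[twpoly iota]_(m, n)) :
  'M[twpoly (eps \o iota)]_(m, n) := map_mx ext_tw M.

End Extension.

(* The generators E_(i x j) c tau^k, 0 <= k < N i j, and their matrices. *)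
Definition gens e d (N : 'M[nat]_(e, d)) : finType :=
  {ij : 'I_e * 'I_d & 'I_(N ij.1 ij.2)}.

Definition gen_mx (F : finFieldType) (K : fieldType)
    (iota : {rmorphism {poly F} -> K}) e d (N : 'M[nat]_(e, d))
    (c : K) (x : gens N) : 'M[twpoly iota]_(e, d) :=
  tmonom iota c (tagged x) *: delta_mx (tag x).1 (tag x).2.

(* Pi, with rows and columns indexed by the generators through r, is the       *)
(* matrix of the multiplication by t on Mat_{<N}: modulo Der_in, the element   *)
(* Psi_t E_(i x j) c tau^k equals the element of Mat_{<N} whose coordinates    *)
(* are the values at c of the column of Pi_t indexed by (i, j, k).  As values  *)
(* on a finite K do not determine a twisted polynomial, c ranges over all the  *)
(* field extensions of K (K itself included), as for an indeterminate c.       *)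
Definition transfers_t (F : finFieldType) (K : fieldType)
    (iota : {rmorphism {poly F} -> K}) (Phi Psi : tmodule iota)
    (N : 'M[nat]_(tdim Psi, tdim Phi)) (Pi : tmodule iota)
    (r : gens N -> 'I_(tdim Pi)) : Prop :=
  forall (L : fieldType) (eps : {rmorphism K -> L}) (c : L) (x : gens N),
  exists V : 'M[twpoly (eps \o iota)]_(tdim Psi, tdim Phi),
    ext_mx eps (Psi 'X) *m gen_mx (eps \o iota) c x
    - \sum_(y : gens N)
        gen_mx (eps \o iota) (tw_eval (ext_tw eps (Pi 'X (r y) (r x))) c) y
    = V *m ext_mx eps (Phi 'X) - ext_mx eps (Psi 'X) *m V.

(* Ext^1_tau(Phi, Psi) has a t-module structure coming from t-reduction. *)
Definition ext_treduction (F : finFieldType) (K : fieldType)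
    (iota : {rmorphism {poly F} -> K}) (Phi Psi : tmodule iota) : Prop :=
  exists (U : 'I_(tdim Psi) -> 'I_(tdim Phi) -> 'M[K]_(tdim Psi, tdim Phi))
         (N : 'M[nat]_(tdim Psi, tdim Phi)),
  [/\ basis_of fullv [seq U ij.1 ij.2 | ij : 'I_(tdim Psi) * 'I_(tdim Phi)],
      cond_A U, cond_B U, cond_N U N & cond_C U N /\ cond_D N] /\
  exists (Pi : tmodule iota) (r : gens N -> 'I_(tdim Pi)),
    bijective r /\ transfers_t r.

(* Main.v *)
(* In coordinates adapted to the composition series, Phi_t and Psi_t are lower *)
(* triangular with the Drinfeld quotients on the diagonal, so every diagonal   *)
(* entry phi_j of Phi_t has larger degree than every diagonal entry psi_i of   *)
(* Psi_t.  Take N i j = deg phi_j and U_(i x j) = lead(phi_j)^-1 E_(i x j).    *)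
(* The matrix c tau^k E_(i x j) Phi_t - Psi_t c tau^k E_(i x j) has an entry   *)
(* of degree k + deg phi_j at (i, j) and otherwise meets only the entries      *)
(* (i, l), l < j, and (l, j), l > i; this triangular pattern makes reduction   *)
(* terminate and forces any V with V Phi_t - Psi_t V in Mat_{<N} to vanish.    *)
(* Modulo q-th powers of c, the product Psi_t c tau^k E_(i x j) is             *)
(* (theta + N_Psi) c tau^k E_(i x j), which is already reduced; hence the      *)
(* constant term of Pi_t is theta plus a copy of N_Psi for every pair (j, k),  *)
(* theta plus a nilpotent matrix.                                              *)

From HB Require Import structures.
Require Import Defs.
From mathcomp Require Import all_boot all_order all_algebra all_fingroup all_field.

Set Implicit Arguments.
Unset Strict Implicit.
Unset Printing Implicit Defensive.

Import GRing.Theory.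
Local Open Scope ring_scope.

(** * Skew polynomials *)

(** An exact sequence of left K{tau}-modules ending in a free module splits, so every step of a
    composition series can be put in block form ([split_short_exact], [exists_presentation]). In
    such coordinates A = Phi_t and B = Psi_t are lower triangular, and their diagonal entries are
    isomorphic to the given Drinfeld quotients; isomorphism preserves the degree, so deg B_ii < deg
    A_jj for all i, j ([presentation_triangular]).

    Everything then rests on the map V |-> V A - B V, with N_ij = deg A_jj. At a nonzero entry of V
    nearest the upper right corner, V_ij A_jj dominates, so a nonzero V never lands in Mat_{<N}
    ([comm_mx_lt_eq0]); this gives condition D and uniqueness in A. Conversely, c tau^k E_ij with k
    >= N_ij is cancelled by a commutator, at the cost of lower powers at (i, j) and of entries
    nearer the lower left corner ([reducible_monom]); this gives C.

    The reduction treats c as a variable, so its coordinates are twisted polynomials in c, the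
    columns of Pi_t. Their constant terms come from those of B alone ([exists_transfer_column]) and
    form theta plus a nilpotent matrix; hence Pi_t defines a t-module
    ([triangular_ext_treduction]). *)

Section SkewMonomials.
Variables (R : nzRingType) (sigma : {rmorphism R -> R}).
Local Notation T := (Defs.skew sigma).
Implicit Types (p q : T) (a b c : R).

Definition skew_monom c (k : nat) : T := skewC sigma c * tau sigma ^+ k.

Lemma coef_skewCM c p i : (skewC sigma c * p : T)`_i = c * p`_i.
Proof.
rewrite coef_skewM big_ord_recl subn0 big1 ?addr0 => [|j _].
  by rewrite /skewC coefC.
by rewrite /skewC coefC mul0r.
Qed.

Lemma coef_skewMtau p i : (p * tau sigma : T)`_i = if i is i'.+1 then p`_i' else 0.
Proof.
rewrite coef_skewM; case: i => [|i].
  by rewrite big_ord1 /tau coefX /= mulr0.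
rewrite big_ord_recr big_ord_recr /= /tau !coefX subnn subSnn.
rewrite -[(0 == 1)%:R]/(0 : R) -[(1 == 1)%:R]/(1 : R) -iterS.
rewrite iter_sigma0 iter_sigma1 mulr0 addr0 mulr1 big1 ?add0r // => j _.
rewrite coefX subSn ?eqSS ?(ltnW (ltn_ord j)) // subn_eq0 leqNgt ltn_ord.
by rewrite iter_sigma0 mulr0.
Qed.

Lemma coef_tauXn k i : (tau sigma ^+ k : T)`_i = (i == k)%:R.
Proof.
elim: k i => [|k IHk] i; first by rewrite expr0 coefC; case: i.
by rewrite exprSr coef_skewMtau; case: i => [|i]; rewrite ?IHk.
Qed.

Lemma coef_skew_monom c k i : (skew_monom c k)`_i = if i == k then c else 0.
Proof. by rewrite coef_skewCM coef_tauXn; case: eqP; rewrite ?mulr1 ?mulr0. Qed.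

Lemma skewC_is_zmod_morphism : zmod_morphism (skewC sigma).
Proof.
move=> a b; apply/polyP=> i; rewrite coefB /skewC !coefC.
by case: eqP; rewrite ?subr0.
Qed.

Lemma skewC_is_monoid_morphism : monoid_morphism (skewC sigma).
Proof.
split=> [//|a b]; apply/polyP=> i; rewrite coef_skewCM /skewC !coefC.
by case: eqP; rewrite ?mulr0.
Qed.

HB.instance Definition _ :=
  GRing.isZmodMorphism.Build R T (skewC sigma) skewC_is_zmod_morphism.
HB.instance Definition _ :=
  GRing.isMonoidMorphism.Build R T (skewC sigma) skewC_is_monoid_morphism.

Lemma tauXn_skewC k c :
  tau sigma ^+ k * skewC sigma c = skewC sigma (iter k sigma c) * tau sigma ^+ k.
Proof.
elim: k => [|k IHk]; first by rewrite expr0 mul1r mulr1.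
by rewrite exprS -mulrA IHk mulrA tau_skewC mulrA.
Qed.

Lemma skew_monomM a b k l :
  skew_monom a k * skew_monom b l = skew_monom (a * iter k sigma b) (k + l).
Proof.
rewrite /skew_monom -mulrA [tau _ ^+ k * _]mulrA tauXn_skewC.
by rewrite rmorphM exprD !mulrA.
Qed.

Lemma skew_monomD k : {morph skew_monom^~ k : a b / a + b}.
Proof. by move=> a b; rewrite /skew_monom rmorphD mulrDl. Qed.

Lemma skew_monomN k : {morph skew_monom^~ k : a / - a}.
Proof. by move=> a; rewrite /skew_monom rmorphN mulNr. Qed.

Lemma skew_monom0 k : skew_monom 0 k = 0.
Proof. by rewrite /skew_monom rmorph0 mul0r. Qed.

Lemma coef_skew_sum (I : Type) (r : seq I) (P : pred I) (G : I -> T) i :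
  (\sum_(x <- r | P x) G x : T)`_i = \sum_(x <- r | P x) (G x)`_i.
Proof.
by apply: (big_morph (fun p : T => p`_i)) => [p q|]; rewrite ?coefD ?coef0.
Qed.

Lemma skew_monom_sum p m : (size p <= m)%N ->
  \sum_(k < m) skew_monom p`_k k = p.
Proof.
move=> le_p_m; apply/polyP=> i; rewrite coef_skew_sum.
under eq_bigr do rewrite coef_skew_monom.
have [lt_i_m|le_m_i] := ltnP i m.
  rewrite (bigD1 (Ordinal lt_i_m)) //= eqxx big1 ?addr0 // => j.
  by rewrite -val_eqE /= eq_sym => /negPf->.
rewrite big1 => [|j _]; first by rewrite nth_default ?(leq_trans le_p_m).
by case: eqP (leq_trans (ltn_ord j) le_m_i) => // ->; rewrite ltnn.
Qed.

End SkewMonomials.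

Section SkewField.
Variables (K : fieldType) (sigma : {rmorphism K -> K}).
Local Notation T := (Defs.skew sigma).
Implicit Types p q : T.

Lemma iter_sigma_eq0 k x : (iter k sigma x == 0) = (x == 0).
Proof. by elim: k => //= k IHk; rewrite fmorph_eq0. Qed.

(** Only the index deg p survives in the convolution: past it p vanishes, before it the
    complementary index exceeds deg q. As sigma is injective, degrees add and there are no zero
    divisors. *)
Lemma coef_skewM_top p q : p != 0 -> q != 0 ->
  (p * q)`_((size p).-1 + (size q).-1)
    = lead_coef p * iter (size p).-1 sigma (lead_coef q).
Proof.
move=> nz_p nz_q; rewrite coef_skewM.
have lt_p: ((size p).-1 < ((size p).-1 + (size q).-1).+1)%N by rewrite ltnS leq_addr.
rewrite (bigD1 (Ordinal lt_p)) //= addKn -!lead_coefE big1 ?addr0 // => j.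
rewrite -val_eqE /= => ne_j; have [lt_j|] := ltnP j (size p).-1.
  rewrite [q`__]nth_default ?iter_sigma0 ?mulr0 //.
  apply: (leq_trans (leqSpred _)); rewrite -addnBAC; last exact: ltnW.
  by rewrite -[X in (X < _)%N]add0n ltn_add2r subn_gt0.
rewrite leq_eqVlt eq_sym (negPf ne_j) /= => lt_j.
by rewrite nth_default ?mul0r // (leq_trans (leqSpred _)).
Qed.

Lemma size_skewM_leq p q : (size (p * q)%R <= (size p + size q).-1)%N.
Proof. exact: size_poly. Qed.

Lemma size_skewM p q : p != 0 -> q != 0 ->
  size (p * q) = (size p + size q).-1.
Proof.
move=> nz_p nz_q; apply/eqP; rewrite eqn_leq size_skewM_leq /=.
have top := coef_skewM_top nz_p nz_q.
have: (p * q)`_((size p).-1 + (size q).-1) != 0.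
  by rewrite top mulf_neq0 ?iter_sigma_eq0 ?lead_coef_eq0.
have: (0 < size p)%N by rewrite size_poly_gt0.
have: (0 < size q)%N by rewrite size_poly_gt0.
case: (size p) (size q) => // a [] //= b _ _; apply: contraNT.
by rewrite addnS /= -ltnNge ltnS => le_pq; rewrite nth_default.
Qed.

Lemma lead_coef_skewM p q : p != 0 -> q != 0 ->
  lead_coef (p * q : T) = lead_coef p * iter (size p).-1 sigma (lead_coef q).
Proof.
move=> nz_p nz_q; rewrite -coef_skewM_top // lead_coefE size_skewM //; congr _`__.
have: (0 < size p)%N by rewrite size_poly_gt0.
have: (0 < size q)%N by rewrite size_poly_gt0.
by case: (size p) (size q) => // a [] //= b _ _; rewrite addnS.
Qed.

Lemma skewM_neq0 p q : p != 0 -> q != 0 -> p * q != 0.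
Proof.
move=> nz_p nz_q; rewrite -lead_coef_eq0 lead_coef_skewM //.
by rewrite mulf_neq0 ?iter_sigma_eq0 ?lead_coef_eq0.
Qed.

Lemma size_skew_monom (c : K) k : c != 0 -> size (skew_monom sigma c k) = k.+1.
Proof.
move=> nz_c; apply/eqP; rewrite eqn_leq; apply/andP; split.
  apply/leq_sizeP=> i lt_k_i; rewrite coef_skew_monom.
  by case: eqP lt_k_i => // ->; rewrite ltnn.
rewrite ltnNge; apply: contraNN nz_c => /leq_sizeP/(_ k (leqnn _)).
by rewrite coef_skew_monom eqxx => ->.
Qed.

Lemma lead_coef_skew_monom (c : K) k : c != 0 -> lead_coef (skew_monom sigma c k) = c.
Proof.
by move=> nz_c; rewrite lead_coefE size_skew_monom //= coef_skew_monom eqxx.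
Qed.

End SkewField.

(** * Degrees and injectivity of V |-> V A - B V *)

Section TwistedCommutator.
Variables (K : fieldType) (sigma : {rmorphism K -> K}).
Local Notation T := (Defs.skew sigma).

(** Degrees add, so p a outgrows b p although the factors stand on different sides; p a then decides
    the size and leading coefficient of p a - b p. *)
Lemma size_skewM_lt (p a b : T) : p != 0 -> (size b < size a)%N ->
  (size (- (b * p))%R < size (p * a)%R)%N.
Proof.
move=> nz_p lt_b_a; have a_gt0: (0 < size a)%N by apply: leq_trans lt_b_a.
have nz_a: a != 0 by rewrite -size_poly_gt0.
rewrite size_polyN (size_skewM nz_p nz_a) (leq_ltn_trans (size_skewM_leq _ _)) //.
have: (0 < size p)%N by rewrite size_poly_gt0.
by case: (size p) => // s _; rewrite addnC !addSn /= ltn_add2l.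
Qed.

Lemma size_skew_comm (p a b : T) : p != 0 -> (size b < size a)%N ->
  size (p * a - b * p : T) = (size p + size a).-1.
Proof.
move=> nz_p lt_b_a; rewrite (size_polyDl (size_skewM_lt nz_p lt_b_a)).
by rewrite size_skewM // -size_poly_gt0 (leq_trans _ lt_b_a).
Qed.

Lemma lead_coef_skew_comm (p a b : T) : p != 0 -> (size b < size a)%N ->
  lead_coef (p * a - b * p : T)
    = lead_coef p * iter (size p).-1 sigma (lead_coef a).
Proof.
move=> nz_p lt_b_a; rewrite (lead_coefDl (size_skewM_lt nz_p lt_b_a)).
by rewrite lead_coef_skewM // -size_poly_gt0 (leq_trans _ lt_b_a).
Qed.

End TwistedCommutator.

Section Triangular.
Variables (K : fieldType) (sigma : {rmorphism K -> K}) (d e : nat).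
Local Notation T := (Defs.skew sigma).
Variables (A : 'M[T]_d) (B : 'M[T]_e).
Hypothesis trigA : forall i j : 'I_d, (i < j)%N -> A i j = 0.
Hypothesis trigB : forall i j : 'I_e, (i < j)%N -> B i j = 0.
Hypothesis size_diag : forall i j, (size (B i i : T) < size (A j j : T))%N.

(** The bound N of the reduction. Being the same in all rows, it makes the generators (i, j, k) a
    product of the rows i with the pairs (j, k). *)
Definition diag_deg : 'M[nat]_(e, d) := \matrix_(i, j) (size (A j j : T)).-1.

Lemma diag_deg_col i i' j : diag_deg i j = diag_deg i' j.
Proof. by rewrite !mxE. Qed.

Lemma size_diag_gt0 (i : 'I_e) j : (0 < size (A j j : T))%N.
Proof. exact: leq_trans (size_diag i j). Qed.

(* Look at a nonzero entry (i, j) of V maximizing j - i: there the matrix      *)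
(* equation only involves the diagonal entries of A and B.                     *)
Lemma size_comm_mx (V : 'M[T]_(e, d)) : V != 0 ->
  exists i j, (diag_deg i j < size ((V *m A - B *m V)%R i j : T))%N.
Proof.
(* [nu] is j - i shifted by e, to stay in the natural numbers. *)
move=> nz_V; pose nu (x : 'I_e * 'I_d) := (x.2 + (e - x.1))%N.
have [x0 nz_x0]: exists x : 'I_e * 'I_d, V x.1 x.2 != 0.
  apply/existsP; apply: contraNT nz_V => /existsPn V0.
  by apply/eqP/matrixP=> i j; rewrite mxE; have /negPn/eqP := V0 (i, j).
case: (@arg_maxnP _ x0 (fun x => V x.1 x.2 != 0) nu) => //= -[i j] /= nz_V_ij maxV.
have V0 a b : (nu (i, j) < nu (a, b))%N -> V a b = 0.
  by rewrite ltnNge => /negP lt_nu; apply/eqP/negPn/negP=> /(maxV (a, b)).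
exists i, j; rewrite !mxE (bigD1 j) //= [X in _ + X - _]big1 ?addr0 => [|l].
  rewrite (bigD1 i) //= [X in _ - (_ + X)]big1 ?addr0 => [|l].
    rewrite size_skew_comm //.
    have := size_diag_gt0 i j.
    have: (0 < size (V i j : T))%N by rewrite size_poly_gt0.
    case: (size (V i j : T)) (size (A j j : T)) => // s [] //= r _ _.
    by rewrite addnS /= ltnS leq_addl.
  rewrite -val_eqE /= neq_ltn => /orP[lt_l_i|lt_i_l]; last by rewrite trigB ?mul0r.
  by rewrite V0 ?mulr0 // /nu /= ltn_add2l ltn_sub2l // ltn_ord.
rewrite -val_eqE /= neq_ltn => /orP[lt_l_j|lt_j_l]; first by rewrite trigA ?mulr0.
by rewrite V0 ?mul0r // /nu /= ltn_add2r.
Qed.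

Lemma comm_mx_lt_eq0 (V : 'M[T]_(e, d)) :
    (forall i j, (size ((V *m A - B *m V)%R i j : T) <= diag_deg i j)%N) -> V = 0.
Proof.
move=> le_V; apply/eqP; apply: contraT => /size_comm_mx[i [j]].
by rewrite ltnNge le_V.
Qed.

End Triangular.

(** * Reduction, uniformly in the coefficient c *)

(** A field extension of K with an endomorphism extending sigma. The extensions in [transfers_t],
    with their q-Frobenius, are instances; so is K itself. *)
Record skew_ext (K : fieldType) (sigma : {rmorphism K -> K}) := SkewExt {
  ext_field : fieldType;
  ext_sigma : {rmorphism ext_field -> ext_field};
  ext_map : {rmorphism K -> ext_field};
  ext_mapE : forall x, ext_map (sigma x) = ext_sigma (ext_map x)
}.

Section ScalarExtension.
Variables (K : fieldType) (sigma : {rmorphism K -> K}) (X : skew_ext sigma).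
Local Notation T := (Defs.skew sigma).
Local Notation L := (ext_field X).
Local Notation s := (ext_sigma X).
Local Notation TL := (Defs.skew s).
Implicit Types (p q : T) (c : L).

Definition ext_skew p : TL := map_poly (ext_map X) p.

(* When sigma is the q-Frobenius, this is the value p(c) of tw_eval. *)
Definition skew_act p c : L := \sum_(m < size p) ext_map X p`_m * iter m s c.

Lemma coef_ext_skew p i : (ext_skew p)`_i = ext_map X p`_i.
Proof. by rewrite coef_map_id0 ?rmorph0. Qed.

Lemma ext_skewD p q : ext_skew (p + q) = ext_skew p + ext_skew q.
Proof. by apply/polyP=> i; rewrite coefD !coef_ext_skew coefD rmorphD. Qed.

Lemma ext_skewN p : ext_skew (- p) = - ext_skew p.
Proof. by apply/polyP=> i; rewrite coefN !coef_ext_skew coefN rmorphN. Qed.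

Lemma ext_skew0 : ext_skew 0 = 0.
Proof. by apply/polyP=> i; rewrite coef_ext_skew !coef0 rmorph0. Qed.

Lemma ext_skew_monom a k :
  ext_skew (skew_monom sigma a k) = skew_monom s (ext_map X a) k.
Proof.
apply/polyP=> i; rewrite coef_ext_skew !coef_skew_monom.
by case: eqP; rewrite ?rmorph0.
Qed.

Lemma iter_ext_map k x : iter k s (ext_map X x) = ext_map X (iter k sigma x).
Proof. by elim: k => //= k ->; rewrite ext_mapE. Qed.

Lemma ext_skew_sum p m : (size p <= m)%N ->
  ext_skew p = \sum_(k < m) skew_monom s (ext_map X p`_k) k.
Proof.
move=> le_p_m; rewrite -[in LHS](skew_monom_sum le_p_m).
rewrite (big_morph _ ext_skewD ext_skew0).
by apply: eq_bigr => k _; rewrite ext_skew_monom.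
Qed.

Lemma skew_act_widen p c m : (size p <= m)%N ->
  skew_act p c = \sum_(k < m) ext_map X p`_k * iter k s c.
Proof.
move=> le_p_m; rewrite /skew_act.
rewrite (big_ord_widen m (fun k => ext_map X p`_k * iter k s c)) //.
rewrite big_mkcond; apply: eq_bigr => k _.
by case: ltnP => // le_p_k; rewrite nth_default // rmorph0 mul0r.
Qed.

Lemma skew_actDl p q c : skew_act (p + q) c = skew_act p c + skew_act q c.
Proof.
pose m := maxn (size p) (size q).
have le_pq : (size (p + q)%R <= m)%N by apply: size_polyD.
rewrite (skew_act_widen c le_pq) (@skew_act_widen p c m) ?leq_maxl //.
rewrite (@skew_act_widen q c m) ?leq_maxr // -big_split.
by apply: eq_bigr => k _; rewrite coefD rmorphD mulrDl.
Qed.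

Lemma skew_act0l c : skew_act 0 c = 0.
Proof. by rewrite /skew_act size_poly0 big_ord0. Qed.

Lemma skew_actNl p c : skew_act (- p) c = - skew_act p c.
Proof.
by apply/eqP; rewrite -addr_eq0 -skew_actDl addNr skew_act0l.
Qed.

Lemma skew_act_monom a k c : skew_act (skew_monom sigma a k) c = ext_map X a * iter k s c.
Proof.
have le_k : (size (skew_monom sigma a k) <= k.+1)%N.
  apply/leq_sizeP=> i lt_k_i; rewrite coef_skew_monom.
  by case: eqP lt_k_i => // ->; rewrite ltnn.
rewrite (skew_act_widen c le_k) big_ord_recr /= coef_skew_monom eqxx big1 ?add0r //.
move=> i _; rewrite coef_skew_monom; case: eqP => [i_k|_].
  by have := ltn_ord i; rewrite i_k ltnn.
by rewrite rmorph0 mul0r.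
Qed.

Lemma skew_act_sum (I : Type) (r : seq I) (P : pred I) (G : I -> T) c :
  skew_act (\sum_(x <- r | P x) G x) c = \sum_(x <- r | P x) skew_act (G x) c.
Proof.
by apply: (big_morph (skew_act^~ c)) => [p q|]; rewrite ?skew_actDl ?skew_act0l.
Qed.

Lemma skew_act1 c : skew_act 1 c = c.
Proof.
rewrite (_ : 1 = skew_monom sigma 1 0) ?skew_act_monom ?rmorph1 ?mul1r //.
by rewrite /skew_monom rmorph1 mul1r.
Qed.

(** Because [ext_map] commutes with sigma, products act as composites; replacing c by p(c) thus
    multiplies coordinates by p on the right. *)
Lemma skew_actM p q c : skew_act (p * q) c = skew_act p (skew_act q c).
Proof.
rewrite -[in LHS](skew_monom_sum (leqnn (size p))) mulr_suml skew_act_sum.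
rewrite [RHS]/skew_act; apply: eq_bigr => k _.
rewrite -[in LHS](skew_monom_sum (leqnn (size q))) mulr_sumr skew_act_sum.
rewrite iter_sigma_sum mulr_sumr; apply: eq_bigr => l _.
rewrite skew_monomM skew_act_monom iterD iter_sigmaM rmorphM -mulrA.
by rewrite iter_ext_map.
Qed.

(** Here and in the next lemma the coefficients of a product are values at c of twisted polynomials
    over K: p_l tau^l when p stands on the left, where tau^l twists c, and a constant when p stands
    on the right, where tau^k twists p_l. *)
Lemma mul_ext_skew_monom p c k m : (size p <= m)%N ->
  ext_skew p * skew_monom s c k
    = \sum_(l < m) skew_monom s (skew_act (skew_monom sigma p`_l l) c) (k + l).
Proof.
move=> le_p_m; rewrite (ext_skew_sum le_p_m) mulr_suml; apply: eq_bigr => l _.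
by rewrite skew_monomM skew_act_monom addnC.
Qed.

Lemma mul_skew_monom_ext p c k m : (size p <= m)%N ->
  skew_monom s c k * ext_skew p
    = \sum_(l < m)
        skew_monom s (skew_act (skew_monom sigma (iter k sigma p`_l) 0) c) (k + l).
Proof.
move=> le_p_m; rewrite (ext_skew_sum le_p_m) mulr_sumr; apply: eq_bigr => l _.
by rewrite skew_monomM skew_act_monom iter_ext_map mulrC.
Qed.

End ScalarExtension.

Lemma scale_delta_mxM (R : nzRingType) m n p (i : 'I_m) (j : 'I_n) (x : R)
    (M : 'M[R]_(n, p)) :
  (x *: delta_mx i j) *m M = \sum_b (x * M j b) *: delta_mx i b.
Proof.
apply/matrixP=> a b; rewrite !mxE summxE (bigD1 j) //= (bigD1 b) //=.
rewrite !mxE !eqxx !andbT big1 => [|l /negPf ne_l]; last first.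
  by rewrite !mxE ne_l andbF mulr0 mul0r.
rewrite big1 => [|l ne_l]; last by rewrite !mxE [b == l]eq_sym (negPf ne_l) andbF mulr0.
by rewrite !addr0; case: (a == i); rewrite ?mulr1 ?mulr0 ?mul0r.
Qed.

Lemma mulmx_scale_delta (R : nzRingType) m n p (i : 'I_n) (j : 'I_p) (x : R)
    (M : 'M[R]_(m, n)) :
  M *m (x *: delta_mx i j) = \sum_a (M a i * x) *: delta_mx a j.
Proof.
apply/matrixP=> a b; rewrite !mxE summxE (bigD1 i) //= (bigD1 a) //=.
rewrite !mxE !eqxx /= big1 => [|l /negPf ne_l]; last by rewrite !mxE ne_l !mulr0.
rewrite big1 => [|l ne_l]; last by rewrite !mxE [a == l]eq_sym (negPf ne_l) mulr0.
by rewrite !addr0 mulrA.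
Qed.

(** * Termination of the reduction *)

Section Reduction.
Variables (K : fieldType) (sigma : {rmorphism K -> K}) (d e : nat).
Local Notation T := (Defs.skew sigma).
Variables (A : 'M[T]_d) (B : 'M[T]_e).
Hypothesis trigA : forall i j : 'I_d, (i < j)%N -> A i j = 0.
Hypothesis trigB : forall i j : 'I_e, (i < j)%N -> B i j = 0.
Hypothesis size_diag : forall i j, (size (B i i : T) < size (A j j : T))%N.
Local Notation N := (diag_deg e A).
Implicit Types p : T.

(* Families are indexed by all c in all extensions of (K, sigma), so that the  *)
(* coordinates R of a reduction are the same twisted polynomials for all of    *)
(* them, while the matrix V realizing it may depend on c.                      *)
Definition family :=
  forall X : skew_ext sigma, ext_field X -> 'M[Defs.skew (ext_sigma X)]_(e, d).

Definition ext_skew_mx (X : skew_ext sigma) m n (M : 'M[T]_(m, n)) :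
  'M[Defs.skew (ext_sigma X)]_(m, n) := map_mx (@ext_skew K sigma X) M.

Definition gen_ext (X : skew_ext sigma) (c : ext_field X) (y : gens N) :
    'M[Defs.skew (ext_sigma X)]_(e, d) :=
  skew_monom (ext_sigma X) c (tagged y) *: delta_mx (tag y).1 (tag y).2.

Definition reduces_to (W : family) (R : gens N -> T) :=
  forall (X : skew_ext sigma) (c : ext_field X),
  exists V : 'M[Defs.skew (ext_sigma X)]_(e, d),
    W X c - \sum_y gen_ext (skew_act (R y) c) y
      = V *m ext_skew_mx X A - ext_skew_mx X B *m V.

Definition reducible (W : family) := exists R, reduces_to W R.

Definition monom_family (i : 'I_e) (j : 'I_d) (k : nat) : family :=
  fun X c => skew_monom (ext_sigma X) c k *: delta_mx i j.

Lemma gen_extD X y : {morph (@gen_ext X)^~ y : c c' / c + c'}.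
Proof. by move=> c c'; rewrite /gen_ext skew_monomD scalerDl. Qed.

Lemma gen_ext0 X y : gen_ext (0 : ext_field X) y = 0.
Proof. by rewrite /gen_ext skew_monom0 scale0r. Qed.

Lemma gen_extN X y : {morph (@gen_ext X)^~ y : c / - c}.
Proof. by move=> c; rewrite /gen_ext skew_monomN scaleNr. Qed.

Lemma eq_reducible (W W' : family) :
  (forall X c, W X c = W' X c) -> reducible W' -> reducible W.
Proof.
by move=> eqW [R redR]; exists R => X c; rewrite eqW; apply: redR.
Qed.

Lemma reduces_toD W W' R R' : reduces_to W R -> reduces_to W' R' ->
  reduces_to (fun X c => W X c + W' X c) (fun y => R y + R' y).
Proof.
move=> redR redR' X c; have [V defV] := redR X c; have [V' defV'] := redR' X c.
exists (V + V'); rewrite mulmxDl mulmxDr opprD addrACA -defV -defV' addrACA.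
rewrite -opprD -big_split; congr (_ - _); apply: eq_bigr => y _.
by rewrite skew_actDl gen_extD.
Qed.

Lemma reducibleD W W' : reducible W -> reducible W' ->
  reducible (fun X c => W X c + W' X c).
Proof. by case=> R redR [R' redR']; eexists; apply: reduces_toD redR redR'. Qed.

Lemma reduces_to_sum (I : finType) (W : I -> family) R :
    (forall x, reduces_to (W x) (R x)) ->
  reduces_to (fun X c => \sum_x W x X c) (fun y => \sum_x R x y).
Proof.
move=> redR X c; have /fin_all_exists[V defV] x := redR x X c.
exists (\sum_x V x); rewrite mulmx_suml mulmx_sumr -sumrB.
rewrite -(eq_bigr _ (fun x _ => defV x)) sumrB exchange_big; congr (_ - _).
apply: eq_bigr => y _; rewrite skew_act_sum.
by apply: (big_morph (fun c' => gen_ext c' y)) => [c1 c2|]; rewrite ?gen_extD ?gen_ext0.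
Qed.

Lemma reducible_sum (I : finType) (W : I -> family) :
  (forall x, reducible (W x)) -> reducible (fun X c => \sum_x W x X c).
Proof. by case/fin_all_exists=> R /reduces_to_sum redR; eexists; apply: redR. Qed.

Lemma reduces_to_act W R p : reduces_to W R ->
  reduces_to (fun X c => W X (skew_act p c)) (fun y => R y * p).
Proof.
move=> redR X c; have [V defV] := redR X (skew_act p c); exists V.
by rewrite -defV; congr (_ - _); apply: eq_bigr => y _; rewrite skew_actM.
Qed.

Lemma reducible_act W p : reducible W ->
  reducible (fun X c => W X (skew_act p c)).
Proof. by case=> R redR; eexists; apply: reduces_to_act redR. Qed.

Lemma reducibleN W : reducible W -> reducible (fun X c => - W X c).
Proof.
case=> R redR; exists (fun y => - R y) => X c; have [V defV] := redR X c.
exists (- V); rewrite mulNmx mulmxN -[RHS]opprD -defV opprD -!sumrN.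
congr (_ + _); apply: eq_bigr => y _.
by rewrite skew_actNl gen_extN.
Qed.

(** Subtracting a commutator changes the realizing matrix and leaves the coordinates [R] alone. *)
Lemma reducible_comm (V : family) W :
    reducible (fun X c =>
      W X c - (V X c *m ext_skew_mx X A - ext_skew_mx X B *m V X c)) ->
  reducible W.
Proof.
case=> R redR; exists R => X c; have [V' defV'] := redR X c; exists (V X c + V').
by rewrite mulmxDl mulmxDr opprD addrACA -defV' [RHS]addrC addrAC subrK.
Qed.

Lemma reducible_mull i j p k :
    (forall l, (l < size p)%N -> reducible (monom_family i j (k + l))) ->
  reducible (fun X c => (ext_skew X p * skew_monom (ext_sigma X) c k) *: delta_mx i j).
Proof.
move=> redM; pose W (l : 'I_(size p)) X c := monom_family i j (k + l)
  (@skew_act _ _ X (skew_monom sigma p`_l l) c).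
apply: (@eq_reducible _ (fun X c => \sum_l W l X c)) => [X c|].
  by rewrite (mul_ext_skew_monom c k (leqnn _)) scaler_suml.
by apply: reducible_sum => l; apply/reducible_act/redM.
Qed.

Lemma reducible_mulr i j p k :
    (forall l, (l < size p)%N -> reducible (monom_family i j (k + l))) ->
  reducible (fun X c => (skew_monom (ext_sigma X) c k * ext_skew X p) *: delta_mx i j).
Proof.
move=> redM; pose W (l : 'I_(size p)) X c := monom_family i j (k + l)
  (@skew_act _ _ X (skew_monom sigma (iter k sigma p`_l) 0) c).
apply: (@eq_reducible _ (fun X c => \sum_l W l X c)) => [X c|].
  by rewrite (mul_skew_monom_ext c k (leqnn _)) scaler_suml.
by apply: reducible_sum => l; apply/reducible_act/redM.
Qed.

Definition monom_coord i j k (y : gens N) : T :=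
  if (tag y == (i, j)) && (tagged y == k :> nat) then 1 else 0.

Lemma monom_reduces_to i j k : (k < N i j)%N ->
  reduces_to (monom_family i j k) (monom_coord i j k).
Proof.
move=> lt_k X c; exists 0; rewrite mul0mx mulmx0 subr0.
pose y0 : gens N := Tagged (fun ij => 'I_(N ij.1 ij.2))
  (Ordinal lt_k : 'I_(N (i, j).1 (i, j).2)).
rewrite (bigD1 y0) //= /monom_coord !eqxx /= skew_act1 big1 ?addr0 ?subrr //.
case=> [[a b] l] ne_y; case: ifP => [|_]; last by rewrite skew_act0l gen_ext0.
case/andP=> /= /eqP[eq_a eq_b] /eqP eq_l; case/eqP: ne_y; subst a b.
by congr existT; apply: val_inj.
Qed.

(** Outer induction on j + (e - i), for all k at once, and inner induction on k. When k >= N_ij a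
    commutator removes c tau^k. What remains lies at (i, j) in degree below k, or at entries (i, b)
    with b < j and (a, j) with a > i in any degree, where the outer measure is smaller. *)
Lemma reducible_monom i j k : reducible (monom_family i j k).
Proof.
have [n] := ubnP (j + (e - i))%N; elim: n i j k => // n IHn i j k.
rewrite ltnS => le_n; elim/ltn_ind: k => k IHk.
have [lt_k|le_k] := ltnP k (N i j).
  by exists (monom_coord i j k); apply: monom_reduces_to.
have N_ij : N i j = (size (A j j : T)).-1 by rewrite mxE.
have nz_a : lead_coef (A j j : T) != 0.
  by rewrite lead_coef_eq0 -size_poly_gt0 (size_diag_gt0 size_diag i).
pose r := (k - N i j)%N.
(* The factor makes p(c) tau^r A_jj start with exactly c tau^k. *)
pose p := skew_monom sigma (iter r sigma (lead_coef (A j j : T))^-1) 0.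
apply: (@reducible_comm (fun X c => monom_family i j r (skew_act p c))).
(* Row j of A without the top term of A_jj, which is the one cancelling c tau^k. *)
pose D b : T :=
  A j b - if b == j then skew_monom sigma (lead_coef (A j j : T)) (N i j) else 0.
pose W : family := fun X c =>
  - (\sum_b (skew_monom (ext_sigma X) c r * ext_skew X (D b)) *: delta_mx i b)
  + \sum_a (ext_skew X (B a i) * skew_monom (ext_sigma X) c r) *: delta_mx a j.
apply: (@eq_reducible _ (fun X c => W X (skew_act p c))) => [X c|].
  rewrite /monom_family scale_delta_mxM mulmx_scale_delta /W opprB addrCA addrC.
  congr (_ + _); last by apply: eq_bigr => a _; rewrite mxE.
  apply/eqP; rewrite subr_eq addrC -sumrN -big_split (bigD1 j) //=.
  rewrite big1 ?addr0 => [|b /negPf ne_b]; last by rewrite /D ne_b subr0 mxE subrr.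
  rewrite -scalerBl -mulrBr mxE -ext_skewN -ext_skewD /D eqxx opprB addrC subrK.
  rewrite ext_skew_monom skew_monomM subnK // skew_act_monom iter_ext_map /=.
  by rewrite mulrAC -rmorphM -iter_sigmaM mulVf // iter_sigma1 rmorph1 mul1r.
apply: reducible_act; apply: reducibleD.
  apply/reducibleN/reducible_sum => b; apply: reducible_mulr => l.
  have [lt_b_j _|lt_j_b|/val_inj eq_b] := ltngtP b j.
  - by apply: IHn; rewrite (leq_trans _ le_n) // ltn_add2r.
  - by rewrite /D trigA // -val_eqE /= gtn_eqF // subrr size_poly0.
  subst b; move=> lt_l; apply: IHk; rewrite -(subnK le_k) ltn_add2l.
  apply: leq_trans lt_l _; rewrite /D eqxx; apply/leq_sizeP => m le_m.
  rewrite coefB coef_skew_monom; case: eqP => [->|/eqP ne_m].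
    by rewrite N_ij subrr.
  rewrite nth_default ?subr0 //; move: le_m ne_m; rewrite N_ij.
  by case: (size (A j j : T)) => // s le_m ne_m; rewrite ltn_neqAle eq_sym ne_m.
apply/reducible_sum => a; apply: reducible_mull => l.
have [lt_a_i|lt_i_a _|/val_inj eq_a] := ltngtP a i.
- by rewrite trigB // size_poly0.
- by apply: IHn; rewrite (leq_trans _ le_n) // ltn_add2l ltn_sub2l // ltn_ord.
(* Here l < size B_ii <= deg A_jj, so the degree r + l stays below k. *)
subst a => lt_l; apply: IHk; rewrite -(subnK le_k) ltn_add2l.
have := size_diag i j; rewrite N_ij; have := leq_trans lt_l.
by case: (size (A j j : T)) => // s lt_ls lt_s; apply: lt_ls.
Qed.

End Reduction.

(** * Transfer of multiplication by t to the reduced matrices *)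

Section Transfer.
Variables (K : fieldType) (sigma : {rmorphism K -> K}) (d e : nat).
Local Notation T := (Defs.skew sigma).
Variables (A : 'M[T]_d) (B : 'M[T]_e).
Hypothesis trigA : forall i j : 'I_d, (i < j)%N -> A i j = 0.
Hypothesis trigB : forall i j : 'I_e, (i < j)%N -> B i j = 0.
Hypothesis size_diag : forall i j, (size (B i i : T) < size (A j j : T))%N.
Local Notation N := (diag_deg e A).
Implicit Types (p : T) (x y : gens N).

(** The case of fixed coefficients in K: w is a sum of monomial matrices, each reduced in the
    trivial extension [X0]. *)
Lemma exists_comm_mx_lt (w : 'M[T]_(e, d)) :
  exists V, forall i j, (size ((w - (V *m A - B *m V))%R i j : T) <= N i j)%N.
Proof.
pose P w := exists V, forall i j, (size ((w - (V *m A - B *m V))%R i j : T) <= N i j)%N.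
have P0 : P 0.
  by exists 0 => i j; rewrite mul0mx mulmx0 !subr0 mxE size_poly0.
have PD w1 w2 : P w1 -> P w2 -> P (w1 + w2).
  case=> V1 le_V1 [V2 le_V2]; exists (V1 + V2) => i j.
  have ->: (V1 + V2) *m A - B *m (V1 + V2)
      = (V1 *m A - B *m V1) + (V2 *m A - B *m V2).
    by rewrite mulmxDl mulmxDr opprD addrACA.
  rewrite opprD addrACA mxE (leq_trans (size_polyD _ _)) // geq_max.
  by rewrite le_V1 le_V2.
pose X0 := @SkewExt K sigma K sigma idfun (fun=> erefl).
have ext_id m n (M : 'M[T]_(m, n)) : ext_skew_mx X0 M = M.
  by apply/matrixP=> i j; rewrite mxE; apply/polyP=> k; rewrite coef_ext_skew.
suff Pw i j k c : P (skew_monom sigma c k *: delta_mx i j).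
  rewrite -/(P w) (matrix_sum_delta w).
  apply: (big_ind P) => // i _; apply: (big_ind P) => // j _.
  rewrite -(skew_monom_sum (leqnn (size (w i j : T)))) scaler_suml.
  by apply: (big_ind P).
have [R /(_ X0 c)[V]] := reducible_monom trigA trigB size_diag i j k.
rewrite /= !ext_id => defV; exists V => a b; rewrite -defV opprB addrC subrK.
rewrite summxE; apply: (big_ind (fun p : T => size p <= N a b)%N).
- by rewrite size_poly0.
- by move=> p q le_p le_q; rewrite (leq_trans (size_polyD _ _)) // geq_max le_p.
move=> [[i' j'] l] _; rewrite /gen_ext /= mxE [delta_mx _ _ _ _]mxE.
case: (a =P i') => [->|_]; last by rewrite ?andbF mulr0 size_poly0.
case: (b =P j') => [->|_]; last by rewrite ?andbF mulr0 size_poly0.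
rewrite mulr1; apply/leq_sizeP=> m le_m; rewrite coef_skew_monom.
case: eqP => // eq_m; move: le_m (ltn_ord l); rewrite eq_m => le_l.
by rewrite ltnNge le_l.
Qed.

Definition shift_coef p : T := \poly_(l < size p) p`_l.+1.

Lemma skew_split0 p : p = skew_monom sigma p`_0 0 + shift_coef p * tau sigma.
Proof.
apply/polyP=> i; rewrite coefD coef_skew_monom coef_skewMtau.
case: i => [|i]; rewrite ?addr0 // add0r coef_poly.
by case: ltnP => // le_p_i; rewrite nth_default // ltnW.
Qed.

Lemma ext_skewMtau (X : skew_ext sigma) p :
  ext_skew X (p * tau sigma) = ext_skew X p * tau (ext_sigma X).
Proof.
apply/polyP=> i; rewrite coef_ext_skew !coef_skewMtau.
by case: i => [|i]; rewrite ?rmorph0 ?coef_ext_skew.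
Qed.

(** Moves a factor tau of the matrix into the argument c, where it becomes a right factor tau of the
    coordinates. *)
Lemma tau_skew_monom (X : skew_ext sigma) c k :
  tau (ext_sigma X) * skew_monom (ext_sigma X) c k
    = skew_monom (ext_sigma X) (skew_act (tau sigma) c) k.+1.
Proof.
have tauE (L : fieldType) (s : {rmorphism L -> L}) : tau s = skew_monom s 1 1.
  by rewrite /skew_monom rmorph1 mul1r expr1.
by rewrite !tauE skew_monomM skew_act_monom rmorph1 !mul1r add1n.
Qed.

Definition gens_same y x :=
  ((tag y).2 == (tag x).2) && (tagged y == tagged x :> nat).

(* Write the entries of B as b_0 + b' tau.  The b_0-part of the column is      *)
(* already reduced, and the other part is a reducible family evaluated at      *)
(* tau(c), which multiplies its coordinates by tau on the right: it does not   *)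
(* contribute to their constant coefficients.                                  *)
Lemma exists_transfer_column x : exists R : gens N -> T,
  reduces_to B (fun X c => ext_skew_mx X B *m gen_ext c x) R /\
  forall y, (R y)`_0 = if gens_same y x then (B (tag y).1 (tag x).1)`_0 else 0.
Proof.
case: x => -[i j] k.
pose W1 a : family sigma d e := fun X c =>
  monom_family a j k (skew_act (skew_monom sigma (B a i)`_0 0) c).
have red1 a : reduces_to B (W1 a)
    (fun y => monom_coord a j k y * skew_monom sigma (B a i)`_0 0).
  by apply/reduces_to_act/monom_reduces_to; rewrite (diag_deg_col A a i) (ltn_ord k).
pose W2 : family sigma d e := fun X c =>
  \sum_a (ext_skew X (shift_coef (B a i)) * skew_monom (ext_sigma X) c k.+1)
         *: delta_mx a j.
have [R2 red2] : reducible A B W2.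
  by apply: reducible_sum => a; apply: reducible_mull => l _; apply: reducible_monom.
exists (fun y => \sum_a monom_coord a j k y * skew_monom sigma (B a i)`_0 0
                 + R2 y * tau sigma).
split=> [X c|y].
  have [V defV] := reduces_toD (reduces_to_sum red1) (reduces_to_act (tau sigma) red2) c.
  exists V; rewrite -defV; congr (_ - _).
  rewrite mulmx_scale_delta -big_split; apply: eq_bigr => a _.
  rewrite /W1 /monom_family /= -scalerDl mxE [in LHS](skew_split0 (B a i)).
  rewrite ext_skewD ext_skewMtau mulrDl.
  rewrite -mulrA tau_skew_monom ext_skew_monom skew_monomM skew_act_monom.
  by [].
rewrite coefD coef_skewMtau addr0 coef_skew_sum /gens_same /monom_coord /=.
case: y => -[a b] l /=.
under eq_bigr do rewrite xpair_eqE -andbA; case: (_ && _); last first.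
  by rewrite big1 // => a' _; rewrite andbF mul0r coef0.
rewrite (bigD1 a) //= eqxx mul1r coef_skew_monom big1 ?addr0 // => a' ne_a'.
by rewrite eq_sym (negPf ne_a') mul0r coef0.
Qed.

(** As N is constant along columns, every row contains exactly one generator with the pair (j, k) of
    [x]. *)
Lemma sum_gens_same (V : nmodType) (x : gens N) (G : 'I_e -> V) :
  \sum_(y | gens_same y x) G (tag y).1 = \sum_i G i.
Proof.
case: x => -[i0 j] k.
have lt_k i : (k < N (i, j).1 (i, j).2)%N by rewrite (diag_deg_col A i i0) (ltn_ord k).
pose h i : gens N := Tagged (fun ij => 'I_(N ij.1 ij.2)) (Ordinal (lt_k i)).
rewrite (reindex_onto h (fun y => (tag y).1)) => [|[[i j'] k']].
  by apply: eq_bigl => i; rewrite /gens_same /= !eqxx.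
case/andP=> /= /eqP eq_j /eqP eq_k; subst j'.
by congr existT; apply: val_inj.
Qed.

(* The Kronecker product of M with the identity on the indices (j, k). *)
Definition gens_mx (M : 'M[K]_e) : 'M[K]_#|gens N| :=
  \matrix_(a, b) if gens_same (enum_val a) (enum_val b)
                 then M (tag (enum_val a)).1 (tag (enum_val b)).1 else 0.

(** Only indices sharing the pair (j, k) of [x] contribute, one per row. Through powers, this
    carries nilpotency of N_Psi over to Pi_t. *)
Lemma gens_mxM M M' : gens_mx (M *m M') = gens_mx M *m gens_mx M'.
Proof.
apply/matrixP=> a b; rewrite !mxE; set y := enum_val a; set x := enum_val b.
rewrite (reindex (@enum_rank (gens N))) /=; last exact/onW_bij/enum_rank_bij.
pose G i := if gens_same y x then M (tag y).1 i * M' i (tag x).1 else 0.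
transitivity (\sum_i G i).
  by rewrite /G; case: ifP => // _; rewrite ?mxE // big1.
rewrite -(sum_gens_same x) big_mkcond; apply: eq_bigr => z _ /=.
rewrite !mxE enum_rankK -/y -/x /G.
have [/andP[/eqP eq_j /eqP eq_k]|_] := boolP (gens_same z x); last by rewrite mulr0.
have ->: gens_same y z = gens_same y x.
  by rewrite /gens_same; congr (_ && _); [rewrite eq_j | rewrite eq_k].
by case: ifP; rewrite ?mul0r.
Qed.

Lemma gens_same_eq y x : gens_same y x -> (tag y).1 = (tag x).1 -> y = x.
Proof.
move: y x => [[i j] k] [[i' j'] k'] /andP[/= /eqP eq_j /eqP eq_k] eq_i.
by subst i' j'; congr existT; apply: val_inj.
Qed.

Lemma gens_mx_scalar a : gens_mx a%:M = a%:M.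
Proof.
apply/matrixP=> b c; rewrite !mxE -(inj_eq enum_val_inj).
have [->|ne_bc] := eqVneq (enum_val b) (enum_val c); first by rewrite /gens_same !eqxx.
case: ifP => // same; case: eqP => // /(gens_same_eq same)/eqP.
by rewrite (negPf ne_bc).
Qed.

Lemma gens_mxX M k : gens_mx (M ^+ k) = gens_mx M ^+ k.
Proof.
elim: k => [|k IHk]; first exact: gens_mx_scalar.
by rewrite !exprS -IHk -!mulmxE gens_mxM.
Qed.

End Transfer.

(** * t-modules given by triangular matrices *)

Section TmoduleShape.
Variables (F : finFieldType) (K : fieldType) (iota : {rmorphism {poly F} -> K}).
Local Notation T := (twpoly iota).

Definition coef0_mx m n (M : 'M[T]_(m, n)) : 'M[K]_(m, n) :=
  \matrix_(i, j) (M i j : T)`_0.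

Lemma coef0_mxM m n p (M : 'M[T]_(m, n)) (M' : 'M[T]_(n, p)) :
  coef0_mx (M *m M') = coef0_mx M *m coef0_mx M'.
Proof.
apply/matrixP=> i j; rewrite !mxE coef_skew_sum; apply: eq_bigr => k _.
by rewrite coef_skewM big_ord1 !mxE.
Qed.

Lemma coef0_mx_scalar n p : coef0_mx (p%:M : 'M[T]_n) = (p`_0)%:M.
Proof. by apply/matrixP=> i j; rewrite !mxE; case: eqP; rewrite ?coef0. Qed.

Lemma mulmx_scalarE (R : nzRingType) m n (M : 'M[R]_(m, n)) a i j :
  (M *m a%:M) i j = M i j * a.
Proof.
rewrite mxE (bigD1 j) //= mxE eqxx big1 ?addr0 // => k /negPf ne_k.
by rewrite mxE ne_k mulr0.
Qed.

(** The higher coefficients are arbitrary, so the shape is a condition on the constant coefficients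
    alone. *)
Lemma tmodule_shapeP n (M : 'M[T]_n) :
  tmodule_shape M <->
  exists N : 'M[K]_n, nilpotent_mx N /\ coef0_mx M = (iota 'X)%:M + N.
Proof.
split=> [[N [m [A [nilN ->]]]]|[N [nilN defN]]].
  exists N; split=> //; apply/matrixP=> i j; rewrite mxE mxE coefD mxE coefC /=.
  rewrite summxE coef_skew_sum big_nat_cond big1 ?addr0 // => k /andP[/andP[k_gt0 _] _].
  by rewrite mulmx_scalarE mxE coef_skew_monom eq_sym gtn_eqF.
pose m := (\max_i \max_j size (M i j : T))%N.
have le_m i j : (size (M i j : T) <= m.+1)%N.
  apply: leqW; apply: leq_trans (@leq_bigmax _ (fun j => size (M i j : T)) j) _.
  exact: (@leq_bigmax _ (fun i => \max_j size (M i j : T)) i)%N.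
exists N, m, (fun k => \matrix_(i, j) (M i j : T)`_k); split=> //.
apply/matrixP=> i j; rewrite -defN !mxE summxE.
rewrite -[LHS](skew_monom_sum (le_m i j)).
rewrite -(big_mkord predT (fun k => skew_monom _ (M i j : T)`_k k)).
rewrite big_ltn //; congr (_ + _); first by rewrite /skew_monom mulr1.
by apply: eq_bigr => k _; rewrite mulmx_scalarE !mxE.
Qed.

(** The q-Frobenius fixes F_q, whose elements are therefore central in K{tau}; this lets evaluation
    at a matrix be a ring morphism on F_q[t]. *)
Lemma skew_const_comm (c : F) (p : T) : GRing.comm (skewC (frobq iota) (iota c%:P)) p.
Proof.
apply/polyP=> i; rewrite coef_skewCM coef_skewM big_ord_recr /= subnn.
rewrite big1 ?add0r => [|j _].
  rewrite /skewC coefC /= mulrC; congr (_ * _).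
  by elim: i => //= i <-; rewrite /frobq -!rmorphXn /= expf_card.
by rewrite /skewC coefC subn_eq0 leqNgt ltn_ord iter_sigma0 mulr0.
Qed.

Lemma mulmx_const (c : F) m n (M : 'M[T]_(m, n)) :
  M *m (skewC (frobq iota) (iota c%:P))%:M = (skewC (frobq iota) (iota c%:P))%:M *m M.
Proof.
apply/matrixP=> i j; rewrite mulmx_scalarE mul_scalar_mx mxE.
by rewrite skew_const_comm.
Qed.

Lemma exists_tmodule n (M : 'M[T]_n) : tmodule_shape M ->
  exists Phi : {rmorphism {poly F} -> 'M[T]_n},
    (forall c, Phi c%:P = (skewC (frobq iota) (iota c%:P))%:M) /\ Phi 'X = M.
Proof.
(* In dimension zero the matrix ring is trivial and the zero map preserves 1; otherwise polynomials
   are evaluated at M. *)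
case: n M => [|n] M shapeM.
  have Z : zmod_morphism (fun _ : {poly F} => 0 : 'M[T]_0) by move=> *; rewrite subrr.
  have U : monoid_morphism (fun _ : {poly F} => 0 : 'M[T]_0).
    by split=> [|a b]; apply: (etrans (flatmx0 _) (esym (flatmx0 _))).
  pose Zm := GRing.isZmodMorphism.Build _ _ _ Z.
  pose Um := GRing.isMonoidMorphism.Build _ _ _ U.
  pose f : {rmorphism {poly F} -> 'M[T]_0} :=
    HB.pack (fun _ : {poly F} => 0 : 'M[T]_0) Zm Um.
  by exists f; split=> [c|]; apply: (etrans (flatmx0 _) (esym (flatmx0 _))).
pose f : {rmorphism F -> 'M[T]_n.+1} :=
  scalar_mx \o (skewC (frobq iota) \o (iota \o polyC)).
have cfM : commr_rmorph f M by move=> c; apply: mulmx_const.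
exists (horner_morph cfM); split=> [c|]; last exact: (horner_morphX cfM).
exact: (horner_morphC cfM).
Qed.

End TmoduleShape.

(** * Conditions A-D for the rescaled elementary matrices *)

Section TriangularReduction.
Variables (F : finFieldType) (K : fieldType) (iota : {rmorphism {poly F} -> K}).
Variables Phi Psi : tmodule iota.
Local Notation T := (twpoly iota).
Local Notation d := (tdim Phi).
Local Notation e := (tdim Psi).
Local Notation A := (Phi 'X).
Local Notation B := (Psi 'X).
Hypothesis trigA : forall i j : 'I_d, (i < j)%N -> A i j = 0.
Hypothesis trigB : forall i j : 'I_e, (i < j)%N -> B i j = 0.
Hypothesis size_diag : forall i j, (size (B i i : T) < size (A j j : T))%N.

Definition monic_scale (j : 'I_d) : K := (lead_coef (A j j : T))^-1.

(** The scalar stands to the right of tau^k, so it is twisted like the leading coefficient of A_jj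
    and cancels it for every k, as condition B requires. *)
Definition red_basis (i : 'I_e) (j : 'I_d) : 'M[K]_(e, d) :=
  monic_scale j *: delta_mx i j.

Local Notation sk j := (skewC (frobq iota) (monic_scale j)).

Lemma lead_diag_neq0 (i : 'I_e) j : lead_coef (A j j : T) != 0.
Proof. by rewrite lead_coef_eq0 -size_poly_gt0 (size_diag_gt0 size_diag i). Qed.

Lemma monic_scale_neq0 (i : 'I_e) j : monic_scale j != 0.
Proof. by rewrite invr_eq0 lead_diag_neq0. Qed.

Lemma skewCmx_red_basis i j : skewCmx iota (red_basis i j) = sk j *: delta_mx i j.
Proof.
apply/matrixP=> a b; rewrite !mxE; case: (_ && _); rewrite ?mulr1 //.
by rewrite !mulr0 rmorph0.
Qed.

Lemma inner_genE c k i j a :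
  inner_gen red_basis c k i j a = inner ((tmonom iota c k * sk j) *: delta_mx i j) a.
Proof. by rewrite /inner_gen skewCmx_red_basis scalerA. Qed.

Lemma innerD (V W : 'M[T]_(e, d)) a :
  inner (V + W) a = inner V a + inner W a :> 'M[T]_(e, d).
Proof. by rewrite /inner mulmxDl mulmxDr opprD addrACA. Qed.

Lemma inner0 a : inner 0 a = 0 :> 'M[T]_(e, d).
Proof. by rewrite /inner mul0mx mulmx0 subr0. Qed.

Lemma inner_sum (I : Type) (r : seq I) (P : pred I) (G : I -> 'M[T]_(e, d)) a :
  inner (\sum_(x <- r | P x) G x) a = \sum_(x <- r | P x) inner (G x) a.
Proof.
by apply: (big_morph (fun V : 'M[T]_(e, d) => inner V a)) => [V W|];
  rewrite ?innerD ?inner0.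
Qed.

Lemma inner_X_inj (V W : 'M[T]_(e, d)) : inner V 'X = inner W 'X -> V = W.
Proof.
move=> eqVW; apply/eqP; rewrite -subr_eq0; apply/eqP.
apply: (comm_mx_lt_eq0 trigA trigB size_diag) => i j.
suff -> : (V - W) *m A - B *m (V - W) = 0 by rewrite mxE size_poly0.
apply/eqP; rewrite -[_ - _]/(inner (V - W) 'X) -(addrK (inner W 'X) (inner _ _)).
by rewrite -innerD subrK eqVW subrr.
Qed.

Lemma inner_gen_diag c k i j :
  (inner_gen red_basis c k i j 'X i j : T)
    = tmonom iota c k * sk j * A j j - B i i * (tmonom iota c k * sk j).
Proof.
rewrite inner_genE /inner scale_delta_mxM mulmx_scale_delta !mxE !summxE.
rewrite (bigD1 j) //= [X in _ - X](bigD1 i) //= !mxE !eqxx !mulr1.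
rewrite big1 ?addr0 => [|b ne_b]; last first.
  by rewrite !mxE [j == b]eq_sym (negPf ne_b) andbF mulr0.
rewrite big1 ?addr0 // => a ne_a.
by rewrite !mxE [i == a]eq_sym (negPf ne_a) mulr0.
Qed.

Lemma tmonom_sk c k j :
  tmonom iota c k * sk j
    = skew_monom (frobq iota) (c * iter k (frobq iota) (monic_scale j)) k.
Proof.
by rewrite -[tmonom _ _ _]/(skew_monom _ _ _) -mulrA tauXn_skewC mulrA -rmorphM.
Qed.

Lemma tmonom_sk_coef_neq0 c k (i : 'I_e) j :
  c != 0 -> c * iter k (frobq iota) (monic_scale j) != 0.
Proof. by move=> nz_c; rewrite mulf_neq0 ?iter_sigma_eq0 ?(monic_scale_neq0 i). Qed.

(** Reading [C i j] as a twisted polynomial turns condition A into the invertibility of right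
    multiplication by [monic_scale j], together with [inner_X_inj]. *)
Lemma sum_inner_gen (C : 'M[{poly K}]_(e, d)) a :
  \sum_i \sum_j \sum_(k < size (C i j)) inner_gen red_basis (C i j)`_k k i j a
    = inner (\matrix_(i, j) ((C i j : T) * sk j)) a.
Proof.
rewrite [X in inner X a]matrix_sum_delta inner_sum; apply: eq_bigr => i _.
rewrite inner_sum; apply: eq_bigr => j _.
rewrite mxE -[X in (X * _) *: _](skew_monom_sum (leqnn (size (C i j)))).
rewrite mulr_suml scaler_suml inner_sum; apply: eq_bigr => k _.
by rewrite inner_genE.
Qed.

Lemma skewC_scaleK (i : 'I_e) j (p : T) :
  p * skewC (frobq iota) (lead_coef (A j j : T)) * sk j = p.
Proof.
by rewrite -mulrA -rmorphM divff ?rmorph1 ?mulr1 ?(lead_diag_neq0 i).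
Qed.

Lemma red_basis_condA : cond_A red_basis.
Proof.
move=> V; pose C : 'M[{poly K}]_(e, d) :=
  \matrix_(i, j) (V i j * skewC (frobq iota) (lead_coef (A j j : T)) : T).
exists C; split=> [a|C' /(_ 'X)].
  rewrite sum_inner_gen; congr inner; apply/matrixP=> i j.
  by rewrite !mxE skewC_scaleK.
rewrite sum_inner_gen => /inner_X_inj defV; apply/matrixP=> i j.
rewrite mxE defV mxE -mulrA -rmorphM mulVf ?rmorph1 ?mulr1 //.
exact: lead_diag_neq0.
Qed.

Lemma red_basis_condB : cond_B red_basis.
Proof.
move=> i j k c nz_c; rewrite inner_gen_diag tmonom_sk.
have nz_x := tmonom_sk_coef_neq0 k i j nz_c.
rewrite lead_coef_skew_comm // -?size_poly_gt0 size_skew_monom //.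
rewrite lead_coef_skew_monom //= -mulrA -iter_sigmaM mulVf ?iter_sigma1 ?mulr1 //.
exact: lead_diag_neq0.
Qed.

Lemma red_basis_condN : cond_N red_basis (diag_deg e A).
Proof.
move=> i j c nz_c; rewrite inner_gen_diag tmonom_sk.
have nz_x := tmonom_sk_coef_neq0 0 i j nz_c.
rewrite size_skew_comm // -?size_poly_gt0 size_skew_monom // mxE.
by rewrite prednK // (size_diag_gt0 size_diag i).
Qed.

(** One commutator suffices, and condition A expands it into finitely many generators. *)
Lemma red_basis_condC : cond_C red_basis (diag_deg e A).
Proof.
move=> delta _; have [V le_V] := exists_comm_mx_lt trigA trigB size_diag (delta 'X).
pose P (W : 'M[T]_(e, d)) := exists s : seq (K * nat * ('I_e * 'I_d)),
  W = \sum_(x <- s) inner_gen red_basis x.1.1 x.1.2 x.2.1 x.2.2 'X.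
suff [s defs] : P (inner V 'X) by exists s; rewrite -defs; apply: le_V.
have P0 : P 0 by exists [::]; rewrite big_nil.
have PD W1 W2 : P W1 -> P W2 -> P (W1 + W2).
  by case=> s1 -> [s2 ->]; exists (s1 ++ s2); rewrite big_cat.
have [C [defV _]] := red_basis_condA V; rewrite defV.
apply: (big_ind P) => // i _; apply: (big_ind P) => // j _; apply: (big_ind P) => // k _.
by exists [:: ((C i j)`_k, nat_of_ord k, (i, j))]; rewrite big_seq1.
Qed.

Lemma red_basis_condD : cond_D (Phi := Phi) (Psi := Psi) (diag_deg e A).
Proof.
move=> delta delta' _ _ le_N le_N' [V /(_ 'X) eqV]; apply/eqP; rewrite -subr_eq0 eqV.
suff -> : V = 0 by rewrite inner0.
apply: (comm_mx_lt_eq0 trigA trigB size_diag) => i j.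
rewrite -[_ - _]/(inner V 'X) -eqV mxE (leq_trans (size_polyD _ _)) //.
by rewrite geq_max le_N mxE size_polyN le_N'.
Qed.

Lemma red_basis_basis :
  basis_of fullv [seq red_basis ij.1 ij.2 | ij : 'I_e * 'I_d].
Proof.
rewrite basisEdim size_image card_prod !card_ord dimvf /dim /= leqnn andbT.
apply/subvP=> V _; rewrite (matrix_sum_delta V).
apply: memv_suml => i _; apply: memv_suml => j _.
have -> : V i j *: delta_mx i j = (V i j * lead_coef (A j j : T)) *: red_basis i j.
  by rewrite scalerA mulfK // lead_diag_neq0.
by apply: memvZ; apply: memv_span; apply: (image_f _ (x := (i, j))).
Qed.

End TriangularReduction.

Lemma tw_evalE (F : finFieldType) (K L : fieldType)
    (iota : {rmorphism {poly F} -> K}) (eps : {rmorphism K -> L})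
    (epsE : forall x, eps (frobq iota x) = frobq (eps \o iota) (eps x)) p c :
  tw_eval (ext_tw eps p) c = @skew_act _ _ (SkewExt epsE) p c.
Proof.
rewrite /tw_eval size_map_poly; apply: eq_bigr => m _.
rewrite -[X in X * _]/(ext_skew (SkewExt epsE) p)`_m coef_ext_skew /=; congr (_ * _).
by elim: (nat_of_ord m) => [|k IHk]; rewrite ?expr1 //= -IHk /frobq -exprM -expnSr.
Qed.

Section TriangularExt.
Variables (F : finFieldType) (K : fieldType) (iota : {rmorphism {poly F} -> K}).
Variables Phi Psi : tmodule iota.
Local Notation T := (twpoly iota).
Local Notation d := (tdim Phi).
Local Notation e := (tdim Psi).
Local Notation A := (Phi 'X).
Local Notation B := (Psi 'X).

Lemma triangular_ext_treduction :
    (forall i j : 'I_d, (i < j)%N -> A i j = 0) ->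
    (forall i j : 'I_e, (i < j)%N -> B i j = 0) ->
    (forall i j, (size (B i i : T) < size (A j j : T))%N) ->
  ext_treduction Phi Psi.
Proof.
move=> trigA trigB size_diag; exists (@red_basis _ _ _ Phi Psi), (diag_deg e A); split.
  split; [exact: red_basis_basis | exact: red_basis_condA | exact: red_basis_condB
         | exact: red_basis_condN
         | split; [exact: red_basis_condC | exact: red_basis_condD]].
have /fin_all_exists[R redR] := exists_transfer_column trigA trigB size_diag.
(* Column b holds the coordinates of Psi_t times the generator b. *)
pose M : 'M[T]_#|gens (diag_deg e A)| := \matrix_(a, b) R (enum_val b) (enum_val a).
have shapeM : tmodule_shape M.
  have [N0 [[k nilN0] defN0]] := (tmodule_shapeP B).1 (tactX Psi).
  apply/tmodule_shapeP; exists (gens_mx A N0); split.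
    exists k; rewrite -gens_mxX nilN0; apply/matrixP=> a b; rewrite !mxE.
    by case: ifP; rewrite ?mxE.
  (* The constant terms of [M] are those of B spread over the pairs (j, k). *)
  rewrite -(gens_mx_scalar e A (iota 'X)); apply/matrixP=> a b; rewrite !mxE.
  rewrite (redR _).2; case: ifP => _; last by rewrite addr0.
  by have /matrixP/(_ (tag (enum_val a)).1 (tag (enum_val b)).1) := defN0; rewrite !mxE.
have [pi [piC piX]] := exists_tmodule shapeM.
have shape_pi : tmodule_shape (pi 'X) by rewrite piX.
exists (TModule piC shape_pi), enum_rank; split; first exact: enum_rank_bij.
move=> L eps c x.
have epsE y : eps (frobq iota y) = frobq (eps \o iota) (eps y) by rewrite /frobq rmorphXn.
have [V defV] := (redR x).1 (SkewExt epsE) c; exists V; rewrite -[RHS]defV.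
congr (_ - _); apply: eq_bigr => y _.
by rewrite /= piX mxE !enum_rankK (tw_evalE epsE).
Qed.

End TriangularExt.

(** * Block presentations of composition series *)

Section SplitSequences.
Variables (F : finFieldType) (K : fieldType) (iota : {rmorphism {poly F} -> K}).
Local Notation T := (twpoly iota).

(** Constant coefficients are multiplicative, which reduces the claim to ranks over K. *)
Lemma skew_mx_inv_dim m n (M : 'M[T]_(m, n)) (M' : 'M[T]_(n, m)) :
  M *m M' = 1%:M -> M' *m M = 1%:M -> m = n.
Proof.
have le k l (P : 'M[T]_(k, l)) Q : P *m Q = 1%:M -> (k <= l)%N.
  move/(congr1 (@coef0_mx _ _ _ _ _)); rewrite coef0_mxM coef0_mx_scalar coefC /=.
  by move/mulmx1_min.
by move=> /le le_mn /le le_nm; apply/eqP; rewrite eqn_leq le_mn.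
Qed.

(** The constant coefficients are conjugated too, which fixes theta and keeps the other part
    nilpotent. *)
Lemma exists_conj_tmodule (Gamma : tmodule iota) n (H : 'M[T]_(n, tdim Gamma))
    (H' : 'M[T]_(tdim Gamma, n)) : H *m H' = 1%:M -> H' *m H = 1%:M ->
  exists Phi : {rmorphism {poly F} -> 'M[T]_n},
    [/\ forall c, Phi c%:P = (skewC (frobq iota) (iota c%:P))%:M,
        tmodule_shape (Phi 'X) & Phi 'X = H *m Gamma 'X *m H'].
Proof.
move=> HH' H'H; pose H0 := coef0_mx H; pose H0' := coef0_mx H'.
have HH0 : H0 *m H0' = 1%:M by rewrite -coef0_mxM HH' coef0_mx_scalar coefC.
have HH0' : H0' *m H0 = 1%:M by rewrite -coef0_mxM H'H coef0_mx_scalar coefC.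
have shapeM : tmodule_shape (H *m Gamma 'X *m H').
  have [N [[k nilN] defN]] := (tmodule_shapeP _).1 (tactX Gamma).
  apply/tmodule_shapeP; exists (H0 *m N *m H0'); split.
    exists k; suff -> : (H0 *m N *m H0') ^+ k = H0 *m N ^+ k *m H0'.
      by rewrite nilN mulmx0 mul0mx.
    elim: k {nilN} => [|k IHk]; first by rewrite !expr0 mulmx1 HH0.
    by rewrite !exprS IHk -!mulmxE !mulmxA -[_ *m H0' *m H0]mulmxA HH0' mulmx1.
  rewrite !coef0_mxM defN mulmxDr mulmxDl; congr (_ + _).
  by rewrite mul_mx_scalar -scalemxAl -/H0 HH0 scalemx1.
have [Phi [PhiC PhiX]] := exists_tmodule shapeM.
by exists Phi; rewrite PhiX.
Qed.

Definition std_inc m n : 'M[T]_(m + n, n) := \matrix_(a, b) ((a == m + b :> nat)%N)%:R.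
Definition std_proj m n : 'M[T]_(m, m + n) := \matrix_(a, b) ((a == b :> nat)%N)%:R.

Lemma std_incE m n : std_inc m n = col_mx 0 1%:M.
Proof.
apply/matrixP=> a b; rewrite !mxE; case: splitP => k eq_a; rewrite !mxE eq_a.
  by rewrite ltn_eqF // ltn_addr.
by rewrite eqn_add2l.
Qed.

Lemma std_projE m n : std_proj m n = row_mx 1%:M 0.
Proof.
apply/matrixP=> a b; rewrite !mxE; case: splitP => k eq_b; rewrite !mxE eq_b //.
by rewrite ltn_eqF // ltn_addr.
Qed.

(** Lifting the standard basis through f gives s. Then 1 - f s is killed by f on the right, so it
    factors as w g; the other identities follow by cancelling g. *)
Lemma split_short_exact (Psi Gamma Phi : tmodule iota) f g :
    @short_exact _ _ _ Psi Gamma Phi f g ->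
  exists (s : 'M[T]_(tdim Psi, tdim Gamma)) (w : 'M[T]_(tdim Gamma, tdim Phi)),
    [/\ s *m f = 1%:M, g *m f = 0, g *m w = 1%:M, s *m w = 0 & f *m s + w *m g = 1%:M].
Proof.
case=> _ _ inj_g ker_f sur_f.
have [r defr] := fin_all_exists (fun i => sur_f (row i 1%:M)).
pose s : 'M[T]_(tdim Psi, tdim Gamma) := \matrix_i r i.
have sf : s *m f = 1%:M.
  by apply/row_matrixP=> i; rewrite row_mul rowK -defr.
have gf : g *m f = 0.
  apply/row_matrixP=> i; rewrite row0 row_mul; apply/ker_f.
  by exists (delta_mx 0 i); rewrite rowE.
have /fin_all_exists[q defq] i :
    exists u : 'rV[T]_(tdim Phi), row i (1%:M - f *m s) = u *m g.
  by apply/ker_f; rewrite -row_mul mulmxBl mul1mx -mulmxA sf mulmx1 subrr row0.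
pose w : 'M[T]_(tdim Gamma, tdim Phi) := \matrix_i q i.
have wg : w *m g = 1%:M - f *m s.
  by apply/row_matrixP=> i; rewrite row_mul rowK defq.
have inj_gmx m (M : 'M[T]_(m, tdim Phi)) : M *m g = 0 -> M = 0.
  move=> Mg0; apply/row_matrixP=> i; rewrite row0; apply: inj_g.
  by rewrite -row_mul Mg0 row0.
exists s, w; split=> //.
- apply/eqP; rewrite -subr_eq0; apply/eqP/inj_gmx.
  by rewrite mulmxBl -mulmxA wg mulmxBr mulmx1 mulmxA gf mul0mx subr0 mul1mx subrr.
- by apply: inj_gmx; rewrite -mulmxA wg mulmxBr mulmx1 mulmxA sf mul1mx subrr.
by rewrite wg addrC subrK.
Qed.

(* For a splitting s of f, the change of coordinates is [g; h s]. *)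
Lemma exists_block_step (Psi Gamma Phi Psi' : tmodule iota) f g
    (h : 'M[T]_(tdim Psi', tdim Psi)) :
    @short_exact _ _ _ Psi Gamma Phi f g -> tisomorphism h ->
  exists (Gamma' : tmodule iota) (H : 'M[T]_(tdim Gamma', tdim Gamma)),
    let inc := \matrix_(a, b) ((a == tdim Phi + b :> nat)%N)%:R in
    let proj := \matrix_(a, b) ((a == b :> nat)%N)%:R in
    [/\ tdim Gamma' = (tdim Phi + tdim Psi')%N, tisomorphism H,
        @short_exact _ _ _ Psi' Gamma' Phi inc proj,
        H *m f = inc *m h & g = proj *m H].
Proof.
move=> ex_fg [mor_h [k [kh hk]]]; have [mor_f mor_g _ _ _] := ex_fg.
have [s [w [sf gf gw sw fswg]]] := split_short_exact ex_fg.
pose H := col_mx g (h *m s); pose H' := row_mx w (f *m k).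
have HH' : H *m H' = 1%:M.
  rewrite mul_col_row gw mulmxA gf mul0mx -[h *m s *m w]mulmxA sw mulmx0.
  by rewrite mulmxA -[h *m s *m f]mulmxA sf mulmx1 hk -scalar_mx_block.
have H'H : H' *m H = 1%:M.
  by rewrite mul_row_col mulmxA -[f *m k *m h]mulmxA kh mulmx1 addrC.
have [rho [rhoC rhoS rhoX]] := exists_conj_tmodule HH' H'H.
pose Gamma' := TModule rhoC rhoS; exists Gamma', H; rewrite /=.
rewrite -/(std_inc (tdim Phi) (tdim Psi')) -/(std_proj (tdim Phi) (tdim Psi')).
have mor_H : H *m Gamma 'X = rho 'X *m H by rewrite rhoX -!mulmxA H'H mulmx1.
have Hf : H *m f = std_inc (tdim Phi) (tdim Psi') *m h.
  by rewrite mul_col_mx gf -mulmxA sf mulmx1 std_incE mul_col_mx mul0mx mul1mx.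
have gH : g = std_proj (tdim Phi) (tdim Psi') *m H.
  by rewrite std_projE mul_row_col mul1mx mul0mx addr0.
split=> //; first by split=> //; exists H'.
split.
- rewrite /tmorphism /= -[LHS]mulmx1 -hk mulmxA -[_ *m Psi' 'X *m h]mulmxA -mor_h.
  rewrite mulmxA -Hf -[_ *m Psi 'X]mulmxA mor_f mulmxA mor_H -[_ *m H *m f]mulmxA Hf.
  by rewrite -!mulmxA hk mulmx1.
- rewrite /tmorphism /= -[LHS]mulmx1 -HH' mulmxA -[_ *m rho 'X *m H]mulmxA -mor_H.
  by rewrite mulmxA -gH mor_g gH -!mulmxA HH' mulmx1.
- move=> v; rewrite std_projE mul_mx_row mulmx1 mulmx0 => /(congr1 lsubmx).
  by rewrite row_mxKl => ->; apply/matrixP=> i j; rewrite !mxE.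
- move=> v; rewrite std_incE std_projE -[v]hsubmxK mul_row_col mulmx0 mulmx1 add0r.
  split=> [->|[u]]; first by exists (lsubmx v); rewrite mul_mx_row mulmx1 mulmx0.
  by rewrite mul_mx_row mulmx0 => /eq_row_mx[].
by move=> v; exists (row_mx 0 v); rewrite std_incE mul_row_col mul0mx mulmx1 add0r.
Qed.

End SplitSequences.

(** With finitely many steps, induction replaces an axiom of choice; [junk] fills the indices beyond
    n. *)
Lemma finite_dependent_choice n (X : nat -> Type) (R : forall i, X i -> X i.+1 -> Prop)
    (junk : forall i, X i) (x0 : X 0%N) :
    (forall i x, (i < n)%N -> exists y, R i x y) ->
  exists f : forall i, X i, f 0%N = x0 /\ forall i, (i < n)%N -> R i (f i) (f i.+1).
Proof.
elim: n X R junk x0 => [|n IHn] X R junk x0 exR.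
  by exists (fun i => if i is i'.+1 then junk i'.+1 else x0).
have [y Ry] := exR 0%N x0 isT.
have [f [f0 Rf]] := IHn (fun i => X i.+1) (fun i => R i.+1) (fun i => junk i.+1) y
  (fun i x lt_i => exR i.+1 x lt_i).
exists (fun i => if i is i'.+1 then f i' else x0); split=> // -[|i] lt_i.
  by rewrite f0.
exact: Rf.
Qed.

(** * Composition series in adapted coordinates *)

Section Presentations.
Variables (F : finFieldType) (K : fieldType) (iota : {rmorphism {poly F} -> K}).
Local Notation T := (twpoly iota).

Lemma tisomorphism_id (Phi : tmodule iota) :
  tisomorphism (1%:M : 'M[T]_(tdim Phi)).
Proof.
by split; [rewrite /tmorphism mulmx1 mul1mx | exists 1%:M; rewrite mulmx1].
Qed.

(** Iterates the block step, carrying along an isomorphism from each member of the series; the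
    quotients are kept as they are. *)
Lemma exists_presentation n (Upsilon : tmodule iota) (S : tau_series n Upsilon) :
  exists Phi : tmodule iota, presentation S Phi.
Proof.
pose X i := {M : tmodule iota & {h : 'M[T]_(tdim M, tdim (ts_mod S i)) | tisomorphism h}}.
pose hom i (x : X i) := sval (projT2 x).
pose inc i (x : X i) (y : X i.+1) : 'M[T]_(tdim (projT1 y), tdim (projT1 x)) :=
  \matrix_(a, b) ((a == tdim (ts_quo S i) + b :> nat)%N)%:R.
pose proj i (y : X i.+1) : 'M[T]_(tdim (ts_quo S i), tdim (projT1 y)) :=
  \matrix_(a, b) ((a == b :> nat)%N)%:R.
pose R i (x : X i) (y : X i.+1) :=
  [/\ tdim (projT1 y) = (tdim (ts_quo S i) + tdim (projT1 x))%N,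
      short_exact (inc i x y) (proj i y),
      hom i.+1 y *m ts_inc S i = inc i x y *m hom i x
    & ts_proj S i = proj i y *m hom i.+1 y].
pose id_X i : X i := existT _ (ts_mod S i) (exist _ 1%:M (tisomorphism_id _)).
have [|f [f0 Rf]] := @finite_dependent_choice n X R id_X (id_X 0%N).
  move=> i [M [h iso_h]] lt_i.
  have [M' [H [dimM' iso_H ex_H H_inc H_proj]]] :=
    exists_block_step (ts_exact S lt_i) iso_h.
  by exists (existT _ M' (exist _ H iso_H)).
have first_f : tdim (projT1 (f 0%N)) = 0%N by rewrite f0 (ts_first S).
have exact_f i (lt_i : (i < n)%N) : short_exact (inc i (f i) (f i.+1)) (proj i (f i.+1)).
  by have [] := Rf i lt_i.
exists (projT1 (f n)).
exists (TauSeries (ts_mod := fun i => projT1 (f i)) (ts_quo := ts_quo S)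
  first_f erefl exact_f (@ts_simple _ _ _ _ _ S)); split.
  by move=> i lt_i; have [] := Rf i lt_i.
exists (fun i => hom i (f i)), (fun i => 1%:M); split=> [i _|i lt_i].
  exact: svalP.
have [_ _ inc_f proj_f] := Rf i lt_i; split=> //; first exact: tisomorphism_id.
by rewrite mul1mx.
Qed.

(** Intertwining with the standard inclusion and projection forces M = [Q, 0; *, M0]. Dimensions
    enter through equations so that they can be substituted, dimensions of t-modules being equal
    only propositionally. *)
Lemma block_stepE D q m (M : 'M[T]_D) (M0 : 'M[T]_m) (Q : 'M[T]_q)
    (f : 'M[T]_(D, m)) (g : 'M[T]_(q, D)) :
    D = (q + m)%N -> q = 1%N ->
    f = \matrix_(a, b) ((a == q + b :> nat)%N)%:R ->
    g = \matrix_(a, b) ((a == b :> nat)%N)%:R ->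
    f *m M0 = M *m f -> g *m M = Q *m g ->
    (forall a b : 'I_m, (a < b)%N -> M0 a b = 0) ->
  (forall a b : 'I_D, (a < b)%N -> M a b = 0) /\
  forall a, (exists x, M a a = Q x x) \/ (exists x, M a a = M0 x x).
Proof.
move=> eqD eq_q -> ->; subst D q.
rewrite -/(std_inc iota 1 m) -/(std_proj iota 1 m) std_incE std_projE.
rewrite -[M]submxK mul_col_mx mul0mx mul1mx mul_block_col !mulmx0 !mulmx1 !add0r.
case/eq_col_mx=> <- <-.
rewrite mul_row_block !mul0mx !mul1mx !addr0 mul_mx_row mulmx1 mulmx0.
case/eq_row_mx=> -> _ trigM0; split=> [a b|a].
  case: (split_ordP a) => a' ->; case: (split_ordP b) => b' -> /=.
  - by rewrite !ord1.
  - by rewrite block_mxEur mxE.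
  - by rewrite [b']ord1.
  by rewrite ltn_add2l block_mxEdr => /trigM0.
by case: (split_ordP a) => a' ->; [left | right]; exists a';
  rewrite (block_mxEul, block_mxEdr).
Qed.

Definition lower_triangular (Phi : tmodule iota) :=
  forall a b : 'I_(tdim Phi), (a < b)%N -> Phi 'X a b = 0.

Lemma block_series_triangular n (Upsilon : tmodule iota) (S : tau_series n Upsilon) :
    block_series S -> (forall i, (i < n)%N -> tdim (ts_quo S i) = 1%N) ->
  lower_triangular Upsilon /\
  forall a, exists i x, (i < n)%N /\ Upsilon 'X a a = ts_quo S i 'X x x.
Proof.
move=> blockS dimS; pose P (M : tmodule iota) := lower_triangular M /\
  forall a, exists i x, (i < n)%N /\ M 'X a a = ts_quo S i 'X x x.
suff: forall i, (i <= n)%N -> P (ts_mod S i).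
  by move/(_ n (leqnn n)); rewrite (ts_last S).
elim=> [_|i IHi lt_i].
  by split=> a; have := ltn_ord a; rewrite {2}(ts_first S).
have [trig_i diag_i] := IHi (ltnW lt_i).
have [eq_dim eq_inc eq_proj] := blockS i lt_i.
have [mor_inc mor_proj _ _ _] := ts_exact S lt_i.
have [trig diag] :=
  block_stepE eq_dim (dimS i lt_i) eq_inc eq_proj mor_inc mor_proj trig_i.
split=> // a; have [[x ->]|[x ->]] := diag a; first by exists i, x.
exact: diag_i.
Qed.

Lemma deg_tau_dim1 (Phi : tmodule iota) (x : 'I_(tdim Phi)) :
  tdim Phi = 1%N -> deg_tau Phi = (size (Phi 'X x x : T)).-1.
Proof.
move=> dim1; have eq_x y : y = x by move: x y; rewrite dim1 => x y; rewrite !ord1.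
rewrite /deg_tau (big_pred1 x) => [|y]; last by rewrite (eq_x y) /= eqxx.
by rewrite (big_pred1 x) // => y; rewrite (eq_x y) /= eqxx.
Qed.

(** In h A = B h with h nonzero, degrees add and deg h cancels. *)
Lemma size_conj_dim1 n m (A : 'M[T]_n) (B : 'M[T]_m) (h : 'M[T]_(m, n)) k x y :
    n = 1%N -> m = 1%N -> h *m A = B *m h -> k *m h = 1%:M ->
  size (B x x : T) = size (A y y : T).
Proof.
move=> eq_n eq_m; subst n m; rewrite !ord1 => /matrixP/(_ 0 0) hA /matrixP/(_ 0 0) kh.
move: hA kh; rewrite !mxE !big_ord1 !ord1 => hA kh.
have nz_h : h 0 0 != 0.
  by apply: contra_eq_neq kh => ->; rewrite mulr0 eq_sym oner_neq0.
have [A0|nz_A] := eqVneq (A 0 0) 0.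
  have [-> | nz_B] := eqVneq (B 0 0) 0; first by rewrite A0.
  by have := skewM_neq0 nz_B nz_h; rewrite -hA A0 mulr0 eqxx.
have [B0|nz_B] := eqVneq (B 0 0) 0.
  by have := skewM_neq0 nz_h nz_A; rewrite hA B0 mul0r eqxx.
have := congr1 (fun p : T => size p) hA; rewrite /= !size_skewM //.
have: (0 < size (h 0%R 0%R : T))%N by rewrite size_poly_gt0.
by case: (size (h 0%R 0%R : T)) => // s _; rewrite addSn addnS /= [RHS]addnC => /addnI.
Qed.

Lemma iso_dim1 (Phi Psi : tmodule iota) (h : 'M[T]_(tdim Psi, tdim Phi)) :
    tisomorphism h -> tdim Phi = 1%N ->
  tdim Psi = 1%N /\ forall x, (size (Psi 'X x x : T)).-1 = deg_tau Phi.
Proof.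
case=> mor_h [k [kh hk]] dim1; have dimPsi := skew_mx_inv_dim hk kh.
split=> [|x]; first by rewrite dimPsi.
have y : 'I_(tdim Phi) by rewrite dim1; apply: ord0.
rewrite (deg_tau_dim1 y dim1); congr predn.
by apply: size_conj_dim1 mor_h kh; rewrite ?dimPsi.
Qed.

(** The quotients of the block series are only isomorphic to those of [S], so dimension and degree
    are transported by [iso_dim1]. *)
Lemma presentation_triangular n (Upsilon Phi : tmodule iota) (S : tau_series n Upsilon) :
    presentation S Phi -> (forall i, (i < n)%N -> tdim (ts_quo S i) = 1%N) ->
  lower_triangular Phi /\
  forall a, exists i, (i < n)%N /\ (size (Phi 'X a a : T)).-1 = deg_tau (ts_quo S i).
Proof.
case=> S1 [blockS1 [h [k [_ iso_k]]]] dimS.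
have quoS1 i : (i < n)%N -> tdim (ts_quo S1 i) = 1%N /\
    forall x, (size (ts_quo S1 i 'X x x : T)).-1 = deg_tau (ts_quo S i).
  by move=> lt_i; have [iso_ki _ _] := iso_k i lt_i; apply: iso_dim1 iso_ki (dimS i lt_i).
have [trig diag] := block_series_triangular blockS1 (fun i lt_i => (quoS1 i lt_i).1).
split=> // a; have [i [x [lt_i ->]]] := diag a.
by exists i; rewrite (quoS1 i lt_i).2.
Qed.

End Presentations.

(** Conditions A-D depend on coordinates: the reduction is obtained in all adapted ones, and the two
    existence clauses keep this from being vacuous. *)
Theorem corollary5p3 (F : finFieldType) (K : fieldType)
    (iota : {rmorphism {poly F} -> K})
    (Upsilon Upsilon' : tmodule iota) (n m : nat)
    (S : tau_series n Upsilon) (S' : tau_series m Upsilon')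
    (hS : forall i, (i < n)%N -> drinfeld (ts_quo S i))
    (hS' : forall j, (j < m)%N -> drinfeld (ts_quo S' j))
    (hdeg : forall i j, (i < n)%N -> (j < m)%N ->
       (deg_tau (ts_quo S' j) < deg_tau (ts_quo S i))%N) :
  [/\ exists Phi : tmodule iota, presentation S Phi,
      exists Psi : tmodule iota, presentation S' Psi
    & forall Phi Psi : tmodule iota,
        presentation S Phi -> presentation S' Psi -> ext_treduction Phi Psi].
Proof.
split; [exact: exists_presentation | exact: exists_presentation | move=> Phi Psi].
case/presentation_triangular=> [i lt_i|trigPhi diagPhi]; first by have [] := hS i lt_i.
case/presentation_triangular=> [j lt_j|trigPsi diagPsi]; first by have [] := hS' j lt_j.
apply: triangular_ext_treduction => // b a.
have [i [lt_i sizePhi]] := diagPhi a; have [j [lt_j sizePsi]] := diagPsi b.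
have := hdeg i j lt_i lt_j; rewrite -sizePhi -sizePsi.
(* Although [.-1] sends 0 to 0, strict inequality of the predecessors still gives that of the
   sizes. *)
by case: (size (Psi 'X b b : twpoly iota)) (size (Phi 'X a a : twpoly iota)) => [|s] [].
Qed.
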